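(* Let $\mathcal D,\mathcal U,\mathcal R$ be real Banach spaces, $D\subset\mathcal D$ and $U\subset\mathcal U$ open, and $R\in C^\infty(D\times U;\mathcal R)$. Let $d^\star\in D$, $u^\star\in U$ satisfy $R(d^\star,u^\star)=0$ and let $\mathrm D_2R(d^\star,u^\star)\in\mathcal B(\mathcal U;\mathcal R)$ be a Banach space isomorphism. Let $D^\star\subset D$ be an open neighbourhood of $d^\star$ and $S^\star\colon D^\star\to U$ the local data-to-solution map, i.e. the unique continuous map with $S^\star(d^\star)=u^\star$ and $R(d,S^\star(d))=0$ for all $d\in D^\star$. Assume that there are real numbers $s\ge 1$ and $\alpha,\varsigma,\digamma\ge 1$ and open neighbourhoods $\tilde D\subset D$ of $d^\star$ and $\tilde U\subset U$ of $u^\star$ with $D^\star\subset\tilde D$ and $S^\star(D^\star)\subset\tilde U$, such that $$\|\mathrm D^nR(d,u)\|_{\mathcal B^n(\mathcal D\times\mathcal U;\mathcal R)}\le (n!)^s\,\varsigma\,\digamma^n\qquad\text{for all } d\in\tilde D,\ u\in\tilde U,\ n\in\mathbb N,$$ and such that, for all $d\in D^\star$, $\mathrm D_2R(d,S^\star(d))$ is a Banach space isomorphism with $$\big\|\big(\mathrm D_2R(d,S^\star(d))\big)^{-1}\big\|_{\mathcal B(\mathcal R;\mathcal U)}\le\alpha .$$ Then the Fréchet derivatives of $S^\star$ satisfy $$\forall n\in\mathbb N^*:\quad \sup_{d\in D^\star}\|\mathrm D^nS^\star(d)\|_{\mathcal B^n(\mathcal D;\mathcal U)}\le (n!)^s\,\tilde\varsigma\,\tilde\digamma^{\,n},$$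 where $$\tilde\varsigma:=\frac{1}{c_\kappa\,\alpha\,\varsigma\,\digamma^2},\qquad \tilde\digamma:=c_\kappa\,\alpha^2\varsigma^2\digamma^3,\qquad c_\kappa:=3+\sqrt 8 .$$
   Context: $\mathbb N=\{0,1,2,\dots\}$, $\mathbb N^*=\{1,2,\dots\}$. For Banach spaces $\mathcal X,\mathcal Y$: $\mathcal B(\mathcal X;\mathcal Y)$ is the space of bounded linear maps and $\mathcal B^n(\mathcal X;\mathcal Y)$ the space of bounded $n$-linear maps $\mathcal X^n\to\mathcal Y$, with the usual operator norms; for $n=0$ this is $\mathcal Y$. The product $\mathcal X\times\mathcal Y$ carries the norm $\max\{\|x\|_{\mathcal X},\|y\|_{\mathcal Y}\}$. $\mathrm D^n$ denotes the $n$-th Fréchet derivative and $\mathrm D_2$ the partial Fréchet derivative with respect to the second argument. By the implicit mapping theorem such $D^\star$ and $S^\star$ exist and $S^\star\in C^\infty(D^\star;\mathcal U)$. *)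

(* Defs.v *)
From HB Require Import structures.
From mathcomp Require Import all_boot all_order all_algebra.
From mathcomp Require Import all_classical all_reals all_analysis.

Set Implicit Arguments.
Unset Strict Implicit.
Unset Printing Implicit Defensive.
Import Order.TTheory GRing.Theory Num.Theory.
Import numFieldNormedType.Exports.
Local Open Scope classical_set_scope.
Local Open Scope ring_scope.

Section BoundedMultilinear.
Context {K : realType} (n : nat) (X Y : normedModType K).
Implicit Types (A B : ('I_n -> X) -> Y) (v : 'I_n -> X).

Definition multilinear A : Prop :=
  forall i v, linear (fun x => A [eta v with i |-> x]).

Definition bounded_multilinear A : Prop :=
  multilinear A /\ exists M : K, forall v, `|A v| <= M * \prod_i `|v i|.

Definition bmlin_pred : {pred ('I_n -> X) -> Y} :=
  fun A => `[< bounded_multilinear A >].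

Record bmlin := Bmlin {
  bmlin_fun :> ('I_n -> X) -> Y ;
  bmlinP : bmlin_fun \in bmlin_pred }.

HB.instance Definition _ := [isSub for bmlin_fun].
HB.instance Definition _ := [Choice of bmlin by <:].

Lemma bmlin_submod_closed : submod_closed bmlin_pred.
Proof.
split.
  apply/asboolP; split=> [i v a x y|]; first by rewrite /= scaler0 addr0.
  by exists 0 => v; rewrite mul0r normr0.
move=> a A B /asboolP[lA [M1 bA]] /asboolP[lB [M2 bB]]; apply/asboolP; split.
  have E w : (a *: A + B) w = a *: A w + B w by [].
  move=> i v c x y; rewrite /= !E (lA i v c x y) (lB i v c x y).
  by rewrite !scalerDr !scalerA [a * c]mulrC addrACA.
exists (`|a| * M1 + M2) => v.
rewrite (le_trans (ler_normD _ _))// mulrDl lerD//.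
by rewrite [leLHS]normrZ -mulrA ler_wpM2l.
Qed.

HB.instance Definition _ := GRing.isSubmodClosed.Build _ _ bmlin_pred
  bmlin_submod_closed.
HB.instance Definition _ := [SubChoice_isSubLmodule of bmlin by <:].

Definition bmlin_norm (A : bmlin) : K :=
  sup [set `|A v| | v in [set v | forall i, `|v i| <= 1]].

Lemma bmlin_multilinear (A : bmlin) : multilinear A.
Proof. by have /asboolP[] := bmlinP A. Qed.

Lemma bmlin_scale (A : bmlin) (c : 'I_n -> K) v :
  A (fun i => c i *: v i) = (\prod_i c i) *: A v.
Proof.
suff H (k : nat) : (k <= n)%N -> A (fun i => if (i < k)%N then c i *: v i else v i) =
    (\prod_(i < n | (i < k)%N) c i) *: A v.
  have := H n (leqnn n).
  rewrite (_ : (fun i => _) = (fun i => c i *: v i)); last first.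
    by apply/funext => i; rewrite ltn_ord.
  by move=> ->; congr (_ *: _); apply: eq_bigl => i; rewrite ltn_ord.
elim: k => [|k IH] kn; first by rewrite big_pred0// scale1r.
pose j := Ordinal kn; pose w (i : 'I_n) := if (i < k)%N then c i *: v i else v i.
rewrite (_ : (fun i : 'I_n => if (i < k.+1)%N then _ else _) =
    [eta w with j |-> c j *: v j + 0]); last first.
  apply/funext => i /=; rewrite addr0 ltnS leq_eqVlt /w.
  by rewrite -[(i : nat) == k]/(i == j); case: eqVneq => // ->.
have A0 : A [eta w with j |-> 0] = 0.
  have := bmlin_multilinear A j w (-1) 0 0.
  by rewrite scaler0 add0r scaleN1r addNr.
rewrite bmlin_multilinear A0 addr0 (_ : [eta w with j |-> v j] = w :> (_ -> _)); last first.
  by apply/funext => i /=; case: eqP => // ->; rewrite /w/= ltnn.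
rewrite IH ?(ltnW kn)// scalerA [in RHS](bigD1 j)//=; congr (_ * _ *: _).
by apply: eq_bigl => i; rewrite ltnS -val_eqE /= andbC -ltn_neqAle.
Qed.

Lemma bmlin_norm_has_sup (A : bmlin) :
  has_sup [set `|A v| | v in [set v | forall i, `|v i| <= 1]].
Proof.
split; first by exists `|A (cst 0)|, (cst 0) => // i; rewrite normr0.
have /asboolP[_ [M bA]] := bmlinP A; exists `|M| => _ [v v1 <-].
rewrite (le_trans (bA v))// (le_trans (ler_norm _))// normrM ler_piMr//.
by rewrite ger0_norm ?prodr_ge0// prodr_ile1// => i; rewrite normr_ge0 v1.
Qed.

Lemma bmlin_norm_le (A : bmlin) v :
  `|A v| <= bmlin_norm A * \prod_i `|v i|.
Proof.
have [[i /eqP vi0]|vn0] := pselect (exists i, v i == 0).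
  rewrite (_ : v = [eta v with i |-> 0]); last first.
    by apply/funext => j /=; case: eqP => // ->.
  have -> : A [eta v with i |-> 0] = 0.
    have := bmlin_multilinear A i v (-1) 0 0.
    by rewrite scaler0 add0r scaleN1r addNr.
  by rewrite normr0 (bigD1 i)//= eqxx normr0 mul0r mulr0.
have vi i : v i != 0 by apply/negP => vi0; apply: vn0; exists i.
have -> : v = fun i => `|v i| *: (`|v i|^-1 *: v i).
  by apply/funext => i; rewrite scalerA divff ?normr_eq0// scale1r.
rewrite bmlin_scale normrZ ger0_norm ?prodr_ge0// mulrC.
rewrite [X in _ <= _ * X](eq_bigr (fun i => `|v i|)); last first.
  by move=> i _; rewrite scalerA divff ?normr_eq0// scale1r.
rewrite ler_wpM2r ?prodr_ge0//.
apply: ub_le_sup; first by have [] := bmlin_norm_has_sup A.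
by eexists=> // i /=; rewrite normrZ normfV normr_id mulVf// normr_eq0.
Qed.

Lemma bmlin_norm_ub (A : bmlin) (M : K) :
  (forall v, (forall i, `|v i| <= 1) -> `|A v| <= M) -> bmlin_norm A <= M.
Proof.
move=> AM; apply: ge_sup; first by have [] := bmlin_norm_has_sup A.
by move=> _ [v v1 <-]; exact: AM.
Qed.

Lemma bmlin_norm_unit (A : bmlin) v :
  (forall i, `|v i| <= 1) -> `|A v| <= bmlin_norm A.
Proof.
move=> v1; apply: ub_le_sup; first by have [] := bmlin_norm_has_sup A.
by exists v.
Qed.

Lemma bmlin_normD (A B : bmlin) :
  bmlin_norm (A + B) <= bmlin_norm A + bmlin_norm B.
Proof.
apply: bmlin_norm_ub => v v1.
by rewrite (le_trans (ler_normD _ _))// lerD// bmlin_norm_unit.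
Qed.

Lemma bmlin_norm_ge0 (A : bmlin) : 0 <= bmlin_norm A.
Proof.
by rewrite (le_trans _ (@bmlin_norm_unit A (cst 0) _))// => i; rewrite normr0.
Qed.

Lemma bmlin_normZ (a : K) (A : bmlin) :
  bmlin_norm (a *: A) = `|a| * bmlin_norm A.
Proof.
have le (b : K) (B : bmlin) : bmlin_norm (b *: B) <= `|b| * bmlin_norm B.
  apply: bmlin_norm_ub => v v1.
  by rewrite [leLHS]normrZ ler_wpM2l// bmlin_norm_unit.
apply/eqP; rewrite eq_le le/=.
have [->|a0] := eqVneq a 0; first by rewrite normr0 mul0r bmlin_norm_ge0.
rewrite -ler_pdivlMl ?normr_gt0// -normfV.
by rewrite -{1}[A](scalerK a0); exact: le.
Qed.

Lemma bmlin_norm0_eq0 (A : bmlin) : bmlin_norm A = 0 -> A = 0.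
Proof.
move=> A0; apply/val_inj/funext => v /=.
by apply/eqP; rewrite -normr_le0 (le_trans (bmlin_norm_le _ _))// A0 mul0r.
Qed.

HB.instance Definition _ := Lmodule_isNormed.Build K bmlin
  bmlin_normD bmlin_normZ bmlin_norm0_eq0.

End BoundedMultilinear.

Section FrechetDerivatives.
Context {K : realType} {X Y : normedModType K}.

(* Junk value 0 if A is not bounded n-linear. *)
Definition to_bmlin n (A : ('I_n -> X) -> Y) : bmlin n X Y := insubd 0 A.

(* D^n f x as an element of B^n(X; Y), built from the library differential:
   D^0 f x is the value f x, and D^(n+1) f x is the differential at x of the map
   D^n f into the normed space B^n(X; Y), uncurried to an (n+1)-linear map. *)
Fixpoint Dn (n : nat) (f : X -> Y) {struct n} : X -> bmlin n X Y :=
  match n with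
  | 0 => fun x => to_bmlin (fun=> f x)
  | m.+1 => fun x => to_bmlin (fun h : 'I_m.+1 -> X =>
              ('d (Dn m f) x : X -> bmlin m X Y) (h ord0) (h \o lift ord0))
  end.

Lemma Dn0E (f : X -> Y) x h : Dn 0 f x h = f x.
Proof.
rewrite /= /to_bmlin val_insubd; case: ifPn => // /negP[].
apply/asboolP; split=> [[]//|].
by exists `|f x| => v; rewrite big_ord0 mulr1.
Qed.

Lemma DnSE n (f : X -> Y) x h : differentiable (Dn n f) x ->
  Dn n.+1 f x h =
  ('d (Dn n f) x : X -> bmlin n X Y) (h ord0) (h \o lift ord0).
Proof.
move=> dfx; rewrite /= /to_bmlin val_insubd; case: ifPn => // /negP[].
set L := 'd (Dn n f) x; apply/asboolP; split=> [i v a u w|].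
  have [j ->|->] := unliftP ord0 i.
    have E z : [eta v with lift ord0 j |-> z] \o lift ord0 =
               [eta (v \o lift ord0) with j |-> z].
      by apply/funext => k /=; rewrite (inj_eq lift_inj).
    by rewrite !E /= bmlin_multilinear.
  have E z : [eta v with ord0 |-> z] \o lift ord0 = v \o lift ord0.
    by apply/funext.
  by rewrite !E /= linearP.
have /linear_bounded_continuous/linear_boundedP := diff_continuous dfx.
move=> /pinfty_ex_gt0[r r0 Lr]; exists r => v.
rewrite big_ord_recl mulrA (le_trans (bmlin_norm_le _ _))//.
by rewrite ler_wpM2r ?prodr_ge0//; exact: Lr.
Qed.

(* f belongs to C^oo(O; Y), for O open; the values of f outside O are irrelevant.
   Differentiability of every D^n f on O entails its continuity. *)
Definition smooth_on (O : set X) (f : X -> Y) : Prop :=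
  forall n x, O x -> differentiable (Dn n f) x.

Definition opnorm (L : X -> Y) : K :=
  sup [set `|L x| | x in [set x | `|x| <= 1]].

Definition bounded_inverse (L : {linear X -> Y}) (M : {linear Y -> X}) : Prop :=
  [/\ continuous L, continuous M, cancel L M & cancel M L].

Definition banach_isomorphism (L : {linear X -> Y}) : Prop :=
  exists M : {linear Y -> X}, bounded_inverse L M.

End FrechetDerivatives.

Section ImplicitMap.
Context {K : realType} {E F G : normedModType K}.

Definition D2 (f : E * F -> G) (d : E) (u : F) : {linear F -> G} :=
  'd (fun v => f (d, v)) u.

Definition continuous_solution (f : E * F -> G) (U : set F) (d0 : E) (u0 : F)
    (N : set E) (S : E -> F) : Prop :=
  [/\ {within N, continuous S}, {homo S : d / N d >-> U d}, S d0 = u0 &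
      forall d, N d -> f (d, S d) = 0].

Definition data_to_solution_map (f : E * F -> G) (U : set F) (d0 : E) (u0 : F)
    (N : set E) (S : E -> F) : Prop :=
  continuous_solution f U d0 u0 N S /\
  forall T, continuous_solution f U d0 u0 N T -> forall d, N d -> T d = S d.

End ImplicitMap.

(* Main.v *)
From HB Require Import structures.
Require Import Defs.
From mathcomp Require Import all_boot all_order all_algebra.
From mathcomp Require Import all_classical all_reals all_analysis.
From mathcomp Require Import ring lra zify.
Import Order.TTheory GRing.Theory Num.Theory.
Import numFieldNormedType.Exports.
Local Open Scope classical_set_scope.
Local Open Scope ring_scope.

(** Differentiating [R (d, S d) = 0] along [n + 1] directions and isolating the
    term containing the top derivative of [S] expresses
    [D2 R (d, S d) (D^(n+1) S d)] through derivatives of [S] of order at most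
    [n]; since [D2 R (d, S d)] is boundedly invertible, this yields both the
    differentiability of [D^n S] and a recursive bound on its norm.

    The recursion is dominated coefficientwise by a power series. As
    [k! i_1! ... i_k! <= (i_1 + ... + i_k)!] for nonzero [i_j], the powers
    [(n!)^(s - 1)] factor out and one may take [s = 1]. With
    [a = alpha vsig dig >= 1], [y = dig * sum_n t^n |D^n S| / n!] is then
    dominated by the solution of [y = a dig t + a y^2 / (1 - y)] (for [a = 1],
    the generating function of the little Schroeder numbers), whose radius of
    convergence is at least [1 / (c a^2 dig)] with [c = 3 + sqrt 8].

    Iterated derivatives are handled as iterated directional derivatives, whose
    values remain in one and the same space. A mean value inequality shows that
    bounds on them that are uniform over unit directions imply differentiability
    of [D^n S] in the operator norm. *)

Set Implicit Arguments.
Unset Strict Implicit.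
Unset Printing Implicit Defensive.

(** * Calculus in normed spaces *)

Section FrechetCalculus.
Context {K : realType} {V W : normedModType K}.
Implicit Types (f g : V -> W) (x : V).

Lemma is_diff_eps f x (L : V -> W) : linear L ->
  (exists k, forall h, `|L h| <= k * `|h|) ->
  (forall e, 0 < e -> exists2 d, 0 < d &
     forall h, `|h| < d -> `|f (h + x) - f x - L h| <= e * `|h|) ->
  is_diff x f L.
Proof.
move=> linL [k Lk] fL.
pose LM := GRing.isLinear.Build _ _ _ _ _ linL.
pose L' : {linear V -> W} := HB.pack L LM.
have Lc : continuous L'.
  apply: bounded_linear_continuous; apply/linear_boundedP.
  exists k; split; first exact: num_real.
  by move=> r /ltW kr h; rewrite (le_trans (Lk h))// ler_wpM2r.
have fo : f \o shift x = cst (f x) + L' +o_ (0 : V) id.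
  apply/eqaddoP => e /fL[d d0 fd]; apply/nbhs_normP; exists d => //= h.
  rewrite /ball_ /= sub0r normrN => /fd.
  by rewrite -[(_ - _) h]/((f \o shift x) h - (f x + L h)) /= opprD addrA.
have E : 'd f x = L' :> (V -> W) by exact: diff_unique.
constructor; last exact: E.
by apply/diff_locallyP; rewrite E; split.
Qed.

Lemma diff_eps f x : differentiable f x -> forall e, 0 < e ->
  exists2 d, 0 < d &
    forall h, `|h| < d -> `|f (h + x) - f x - 'd f x h| <= e * `|h|.
Proof.
move=> /diff_locallyP[_ /eqaddoP fo] e /fo /nbhs_normP[d d0 fd].
exists d => // h hd; have := fd h; rewrite /ball_ /= sub0r normrN => /(_ hd).
by rewrite -[(_ - _) h]/((f \o shift x) h - (f x + 'd f x h)) /= opprD addrA.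
Qed.

Lemma diff_bounded f x : differentiable f x ->
  exists2 k, 0 < k & forall h, `|'d f x h| <= k * `|h|.
Proof. by move=> /diff_continuous /linear_lipschitz. Qed.

Lemma near_eq_is_diff f g x (L : V -> W) : {near x, f =1 g} ->
  is_diff x f L -> is_diff x g L.
Proof.
move=> /nbhs_normP[d0 d00 fg] [df <-]; apply: is_diff_eps => [||e /(diff_eps df)].
- exact: linearP.
- by have [k _ kP] := diff_bounded df; exists k.
move=> [d dp fd]; exists (Num.min d d0); first by rewrite lt_min dp.
move=> h; rewrite lt_min => /andP[hd hd0]; rewrite -!fg ?fd//=.
  by rewrite subrr normr0.
by rewrite opprD addrCA subrr addr0 normrN.
Qed.

Lemma open_eq_is_diff f g x (L : V -> W) {O : set V} : open O -> O x ->
  {in O, f =1 g} -> is_diff x f L -> is_diff x g L.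
Proof.
move=> oO Ox fg; apply: near_eq_is_diff.
apply: filterS (open_nbhs_nbhs (conj oO Ox)) => y Oy.
by apply: fg; rewrite inE.
Qed.

Lemma open_eq_differentiable f g x (O : set V) : open O -> O x ->
  {in O, f =1 g} -> differentiable f x -> differentiable g x.
Proof.
move=> oO Ox fg /differentiableP df.
by have [] := open_eq_is_diff oO Ox fg df.
Qed.

Lemma open_eq_diff f g x (O : set V) : open O -> O x ->
  {in O, f =1 g} -> differentiable f x -> 'd f x = 'd g x :> (V -> W).
Proof.
move=> oO Ox fg /differentiableP df.
by have [_ ->] := open_eq_is_diff oO Ox fg df.
Qed.

End FrechetCalculus.

Section BilinearDerivative.
Context {K : realType} {X U V W : normedModType K}.

(** Norm at most 1 covers both uses: partial application of a multilinear map ([papp]) and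
    evaluation of a 1-linear one. *)
Definition contractive_bilinear (B : U -> V -> W) : Prop :=
  [/\ forall v, linear (B^~ v), forall u, linear (B u)
    & forall u v, `|B u v| <= `|u| * `|v|].

Context {B : U -> V -> W} (Bb : contractive_bilinear B).

Lemma is_diff_contractive_bilinear (f : X -> U) (g : X -> V) x df dg :
  is_diff x f df -> is_diff x g dg ->
  is_diff x (fun y => B (f y) (g y)) (fun h => B (df h) (g x) + B (f x) (dg h)).
Proof.
move=> [dif <-] [dig <-]; have [Bl Br Bn] := Bb.
have B0l v : B 0 v = 0.
  by have := Bl v (-1) 0 0; rewrite scaler0 add0r scaleN1r addNr.
have B0r u : B u 0 = 0.
  by have := Br u (-1) 0 0; rewrite scaler0 add0r scaleN1r addNr.
have BDl u u' v : B (u + u') v = B u v + B u' v.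
  by have := Bl v 1 u u'; rewrite !scale1r.
have BDr u v v' : B u (v + v') = B u v + B u v'.
  by have := Br u 1 v v'; rewrite !scale1r.
have [kf kf0 kfP] := diff_bounded dif.
have [kg kg0 kgP] := diff_bounded dig.
apply: is_diff_eps => [a h h'||e e0].
- by rewrite !linearP Bl Br scalerDr addrACA.
- exists (kf * `|g x| + `|f x| * kg) => h.
  rewrite (le_trans (ler_normD _ _))// mulrDl lerD// (le_trans (Bn _ _))//.
    by rewrite mulrAC ler_wpM2r.
  by rewrite -mulrA ler_wpM2l.
pose c := `|f x| + `|g x| + 1.
have c0 : 0 < c by rewrite ltr_wpDl// addr_ge0.
have e2c : 0 < e / (2 * c) by rewrite divr_gt0// mulr_gt0.
have [d1 d10 fP] := diff_eps dif e2c.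
have [d2 d20 gP] := diff_eps dig e2c.
pose kf' := kf + e / (2 * c); pose kg' := kg + e / (2 * c).
have kf'0 : 0 < kf' by rewrite addr_gt0.
have kg'0 : 0 < kg' by rewrite addr_gt0.
(* The increments of [f] and [g] are at most kf' |h| and kg' |h|, so their product is at most (e /
   2) |h| once |h| < [d3]. The other half of [e] pays for the two terms containing a single
   remainder. *)
pose d3 := e / 2 / (kf' * kg').
have d30 : 0 < d3 by rewrite !divr_gt0// mulr_gt0.
exists (Num.min (Num.min d1 d2) d3); first by rewrite !lt_min d10 d20.
move=> h; rewrite !lt_min => /andP[/andP[hd1 hd2] hd3].
have {fP} := fP h hd1; have {gP} := gP h hd2.
set rg := _ - 'd g x h; set rf := _ - 'd f x h => rgP rfP.
have fE : f (h + x) = f x + ('d f x h + rf).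
  by rewrite /rf [X in _ = _ + X]addrC subrK [RHS]addrC subrK.
have gE : g (h + x) = g x + ('d g x h + rg).
  by rewrite /rg [X in _ = _ + X]addrC subrK [RHS]addrC subrK.
have dfP : `|'d f x h + rf| <= kf' * `|h|.
  by rewrite (le_trans (ler_normD _ _))// mulrDl lerD.
have dgP : `|'d g x h + rg| <= kg' * `|h|.
  by rewrite (le_trans (ler_normD _ _))// mulrDl lerD.
have -> : B (f (h + x)) (g (h + x)) - B (f x) (g x) -
    (B ('d f x h) (g x) + B (f x) ('d g x h)) =
  B rf (g x) + B (f x) rg + B ('d f x h + rf) ('d g x h + rg).
  rewrite fE gE; move: ('d f x h) ('d g x h) => a b.
  rewrite BDl (BDr (f x)) (BDr (f x)) (BDr (_ + _) (g x)) (BDl a rf (g x)).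
  apply/eqP; rewrite !subr_eq; apply/eqP.
  by rewrite [RHS](AC (3*2*1) ((6*(5*2))*((4*1)*3))).
rewrite (le_trans (ler_normD _ _))// (splitr e) mulrDl lerD//.
  rewrite (le_trans (ler_normD _ _))//.
  rewrite (le_trans (lerD (Bn _ _) (Bn _ _)))//.
  apply: (@le_trans _ _ (e / (2 * c) * `|h| * `|g x| + `|f x| * (e / (2 * c) * `|h|))).
    by rewrite lerD// ?ler_wpM2r// ler_wpM2l.
  have -> : e / 2 * `|h| = e / (2 * c) * `|h| * c.
    by field; rewrite gt_eqF.
  rewrite [X in _ + X]mulrC -mulrDr ler_wpM2l//.
    by rewrite mulr_ge0// ltW.
  by rewrite /c; lra.
rewrite (le_trans (Bn _ _))//.
apply: (@le_trans _ _ (kf' * `|h| * (kg' * `|h|))); first by rewrite ler_pM.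
rewrite mulrA ler_wpM2r// mulrAC -ler_pdivlMl ?mulr_gt0//.
by rewrite mulrC ltW.
Qed.

End BilinearDerivative.

Section MeanValueInequality.
Context {K : realType} {V W : normedModType K}.
Implicit Types (f : V -> W) (x h : V).

(** Continuous induction along the segment, as [f] is vector valued: for every [e > 0] the set [A]
    of parameters [t] at which the increment is at most [(M + e) * t] contains its supremum, and a
    supremum below 1 could be exceeded. *)
Lemma mean_value_inequality f x h (M : K) :
  (forall t, 0 <= t <= 1 -> differentiable f (x + t *: h)) ->
  (forall t, 0 <= t <= 1 -> `|'d f (x + t *: h) h| <= M) ->
  `|f (x + h) - f x| <= M.
Proof.
move=> dif difM; apply/ler_addgt0Pr => e e0.
have h1 : 0 < `|h| + 1 by rewrite ltr_wpDl.
have M0 : 0 <= M by rewrite (le_trans _ (difM 0 _))// lexx ler01.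
(* near every point of the segment the increment of f has slope at most M + e *)
have loc t : 0 <= t <= 1 -> exists2 d, 0 < d & forall u, `|u - t| < d ->
    `|f (x + u *: h) - f (x + t *: h)| <= (M + e) * `|u - t|.
  move=> t01; have e'0 : 0 < e / (`|h| + 1) by rewrite divr_gt0.
  have [d d0 fd] := diff_eps (dif t t01) e'0.
  exists (d / (`|h| + 1)); first by rewrite divr_gt0.
  move=> u; rewrite ltr_pdivlMr// => ud.
  have /fd : `|(u - t) *: h| < d.
    by rewrite normrZ (le_lt_trans _ ud)// ler_wpM2l// lerDl.
  have -> : (u - t) *: h + (x + t *: h) = x + u *: h.
    by rewrite addrCA -scalerDl subrK.
  rewrite linearZ /= normrZ => fe.
  rewrite -[X in `|X|](subrK ((u - t) *: 'd f (x + t *: h) h)).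
  rewrite (le_trans (ler_normD _ _))// mulrDl addrC lerD//.
    by rewrite normrZ mulrC ler_wpM2r// difM.
  rewrite (le_trans fe)// mulrCA mulrC ler_wpM2r// mulrAC ler_pdivrMr//.
  by rewrite ler_wpM2l ?ltW// ltrDl.
pose A := [set t | 0 <= t <= 1 /\ `|f (x + t *: h) - f x| <= (M + e) * t].
have A0 : A 0 by rewrite /A /= lexx ler01 scale0r addr0 subrr normr0 mulr0.
have supA : has_sup A by split; [exists 0|exists 1 => t [/andP[]]].
have A01 : 0 <= sup A <= 1.
  apply/andP; split; first by apply: ub_le_sup => //; case: supA.
  by apply: ge_sup; [exists 0|move=> t [/andP[]]].
have Me0 : 0 <= M + e by rewrite addr_ge0// ltW.
have AsupA : A (sup A).
  have [d d0 dP] := loc _ A01; split=> //.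
  have [t At td] := sup_adherent d0 supA.
  have tA : t <= sup A by apply: ub_le_sup => //; case: supA.
  have [_ tM] := At.
  have tAd : `|t - sup A| < d.
    by rewrite ler0_norm ?subr_le0// opprB ltrBlDr addrC -ltrBlDr.
  have := dP t tAd; rewrite ler0_norm ?subr_le0// opprB => dt.
  rewrite -(subrK (f (x + t *: h)) (f _)) -addrA.
  rewrite (le_trans (ler_normD _ _))// -[X in _ * X](subrK t) mulrDr lerD//.
  by rewrite distrC.
have : sup A = 1.
  apply/eqP; rewrite eq_le; have /andP[_ ->] := A01; rewrite /= leNgt.
  apply/negP => A1; have [d d0 dP] := loc _ A01.
  pose t := Num.min (sup A + d / 2) 1.
  have At : sup A < t by rewrite lt_min A1 andbT ltrDl divr_gt0.
  suff /(ub_le_sup (proj2 supA)) : A t by rewrite leNgt At.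
  have /andP[A0' _] := A01.
  split; first by rewrite (le_trans A0' (ltW At)) ge_min lexx orbT.
  have tA0 : 0 <= t - sup A by rewrite subr_ge0 ltW.
  have /dP : `|t - sup A| < d.
    rewrite ger0_norm// ltrBlDl gt_min ltrD2l.
    by rewrite ltr_pdivrMr// ltr_pMr// ltr1n.
  rewrite ger0_norm// => tA; have [_ AM] := AsupA.
  rewrite -(subrK (f (x + sup A *: h)) (f _)) -addrA.
  by rewrite (le_trans (ler_normD _ _))// -[X in _ * X](subrK (sup A)) mulrDr lerD.
by move=> A1; move: AsupA => [_]; rewrite A1 scale1r mulr1.
Qed.

(** Two applications of the mean value inequality: to [f] minus its differential at [x], then to
    [y |-> 'd f y h], which bounds the derivative of that difference in the direction [h]. *)
Lemma taylor1_inequality f x h (C : K) :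
  (forall t, 0 <= t <= 1 -> differentiable f (x + t *: h)) ->
  (forall t, 0 <= t <= 1 ->
     differentiable (fun y => 'd f y h) (x + t *: h)) ->
  (forall t, 0 <= t <= 1 ->
     `|'d (fun y => 'd f y h) (x + t *: h) h| <= C) ->
  `|f (x + h) - f x - 'd f x h| <= C.
Proof.
move=> df d2f d2fC.
have t01 : 0 <= (0 : K) <= 1 by rewrite lexx ler01.
have C0 : 0 <= C by rewrite (le_trans _ (d2fC 0 _)).
have dfx : differentiable f x by have := df 0 t01; rewrite scale0r addr0.
pose L : {linear V -> W} := 'd f x.
have Lc : continuous L by exact: diff_continuous.
have dF t : 0 <= t <= 1 -> is_diff (x + t *: h) (f - (L : V -> W))
    (('d f (x + t *: h) : V -> W) - (L : V -> W)).
  move=> /df /differentiableP dft; apply: is_diffB.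
  by constructor; [exact: linear_differentiable|rewrite diff_lin].
have -> : f (x + h) - f x - 'd f x h =
    (f - (L : V -> W)) (x + h) - (f - (L : V -> W)) x.
  rewrite -[RHS]/(f (x + h) - L (x + h) - (f x - L x)) linearD.
  by rewrite !opprD opprK [RHS]addrACA [- L x + _ + _]addrAC addNr add0r.
apply: mean_value_inequality.
  by move=> t /dF[].
move=> t /[dup] t1 /dF[_ ->]; rewrite fctE.
apply: (@mean_value_inequality (fun y => 'd f y h) x (t *: h)) => u u01.
  rewrite scalerA; apply: d2f.
  by move: t1 u01 => /andP[? ?] /andP[? ?]; rewrite mulr_ge0// mulr_ile1.
rewrite scalerA linearZ normrZ.
have ut : 0 <= u * t <= 1.
  by move: t1 u01 => /andP[? ?] /andP[? ?]; rewrite mulr_ge0// mulr_ile1.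
move: t1 => /andP[t0 t1].
by rewrite -[C]mul1r ler_pM ?ger0_norm ?d2fC.
Qed.

End MeanValueInequality.

Section ImplicitDifferentiation.
Context {K : realType} {X V W : normedModType K}.
Implicit Types (F : X * V -> W) (u : X -> V) (x : X).

(** Taking [v = u x] bounds |u y - u x| by alpha |F (y, u x)|, which tends to |F (x, u x)| = 0. *)
Lemma implicit_continuous F u x (alpha : K) : 0 < alpha ->
  differentiable F (x, u x) -> F (x, u x) = 0 ->
  (\forall y \near x, F (y, u y) = 0 /\
     forall v, `|u y - v| <= alpha * `|F (y, u y) - F (y, v)|) ->
  {for x, continuous u}.
Proof.
move=> a0 dF F0 uF.
have cF : (fun y => F (y, u x)) y @[y --> x] --> (0 : W).
  rewrite -F0; apply: (@continuous_comp _ _ _ (fun y => (y, u x)) F).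
    by apply: cvg_pair => //=; exact: cvg_cst.
  exact: differentiable_continuous.
apply/cvgrPdist_le => e e0; near=> y.
have [Fy /(_ (u x))] : F (y, u y) = 0 /\
     forall v, `|u y - v| <= alpha * `|F (y, u y) - F (y, v)| by near: y.
rewrite distrC Fy => /le_trans; apply.
rewrite -ler_pdivlMl//; near: y.
by move/cvgrPdist_le : cF; apply; rewrite mulr_gt0// invr_gt0.
Unshelve. all: by end_near. Qed.

(** With [v] the increment of [u] and [L] the differential of [F], the left inverse [M] gives
    [v + M (L (h, 0)) = M (L (h, v))]. As [F] vanishes along the graph of [u], [L (h, v)] is o(|h| +
    |v|), and it remains to see that |v| = O(|h|). *)
Lemma implicit_is_diff F u x (M : W -> V) (alpha : K) : 0 < alpha ->
  differentiable F (x, u x) -> {for x, continuous u} ->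
  (\forall y \near x, F (y, u y) = 0) ->
  linear M -> (forall w, `|M w| <= alpha * `|w|) ->
  (forall v, M ('d F (x, u x) (0, v)) = v) ->
  is_diff x u (fun h => - M ('d F (x, u x) (h, 0))).
Proof.
move=> a0 dF cu uF linM Ma MF.
have MD w w' : M (w + w') = M w + M w'.
  by have := linM 1 w w'; rewrite !scale1r.
have [k k0 kP] := diff_bounded dF.
set L := 'd F (x, u x) in MF kP *.
have Lh h : `|M (L (h, 0))| <= alpha * k * `|h|.
  rewrite (le_trans (Ma _))// -mulrA ler_wpM2l ?(ltW a0)// (le_trans (kP _))//.
  by rewrite ler_wpM2l ?(ltW k0)// prod_normE/= normr0 ge_max lexx normr_ge0.
apply: is_diff_eps => [c h h'|/=|e e0].
- rewrite -[(c *: h + h', 0)]/(_, 0 : V).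
  have -> : (c *: h + h', 0) = c *: (h, 0) + (h', 0) :> X * V.
    by congr pair; rewrite /= scaler0 addr0.
  by rewrite linearP linM opprD scalerN.
- by exists (alpha * k) => h; rewrite normrN.
(* Solving |v| <= (|h| + |v|) / 2 + alpha k |h| for |v| gives |v| <= c |h|, hence |h| + |v| <= (c +
   1) |h|. The two entries of the minimum in [e'] serve these two estimates. *)
pose c := 2 * (alpha * k) + 1.
have c0 : 0 < c + 1 by rewrite !addr_gt0// !mulr_gt0.
pose e' := Num.min (1 / 2) (e / (c + 1)) / alpha.
have e'0 : 0 < e' by rewrite divr_gt0// lt_min !divr_gt0.
have [d d0 FP] := diff_eps dF e'0.
have Fx0 : F (x, u x) = 0 by move: uF => /nbhs_singleton.
have : \forall y \near x, F (y, u y) = 0 /\ `|u x - u y| < d.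
  by apply: filterI => //; move/cvgrPdist_lt : cu; apply.
move=> /nbhs_normP[d1 d10 d1P].
exists (Num.min d d1); first by rewrite lt_min d0.
move=> h; rewrite lt_min => /andP[hd hd1].
have [Fh uh] : F (h + x, u (h + x)) = 0 /\ `|u x - u (h + x)| < d.
  by apply: d1P; rewrite /ball_ /= opprD addrCA subrr addr0 normrN.
set v := u (h + x) - u x.
have vd : `|v| < d by rewrite /v distrC.
have := FP (h, v); rewrite prod_normE/= gt_max hd vd => /(_ isT).
have -> : (h, v) + (x, u x) = (h + x, u (h + x)).
  by congr pair; rewrite /v /= subrK.
rewrite Fh Fx0 subrr sub0r normrN -/L => Lhv.
have E : v + M (L (h, 0)) = M (L (h, v)).
  rewrite -[X in X + _]MF -MD -linearD; congr (M (L _)).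
  by congr pair; rewrite /= ?add0r ?addr0.
rewrite opprK E.
have hv : Num.max `|h| `|v| <= `|h| + `|v|.
  by rewrite ge_max lerDl lerDr !normr_ge0.
have M1 : `|M (L (h, v))| <= Num.min (1 / 2) (e / (c + 1)) * (`|h| + `|v|).
  rewrite (le_trans (Ma _))// mulrC -ler_pdivlMr// (le_trans Lhv)//.
  by rewrite [leRHS]mulrAC ler_wpM2l// ltW.
have vh : `|v| <= c * `|h|.
  have : `|v| <= `|M (L (h, v))| + `|M (L (h, 0))|.
    by rewrite -E -{1}[v](addrK (M (L (h, 0)))) ler_normB.
  have : `|M (L (h, v))| <= 1 / 2 * (`|h| + `|v|).
    by rewrite (le_trans M1)// ler_wpM2r ?addr_ge0// ge_min lexx.
  by have := Lh h; rewrite /c; lra.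
rewrite (le_trans M1)// (@le_trans _ _ (e / (c + 1) * (`|h| + `|v|)))//.
  by rewrite ler_wpM2r ?addr_ge0// ge_min lexx orbT.
rewrite -mulrA ler_wpM2l ?(ltW e0)// mulrC ler_pdivrMr// mulrC mulrDl mul1r.
by rewrite addrC lerD2r.
Unshelve. all: by end_near. Qed.

End ImplicitDifferentiation.

Section BoundedMultilinearEvaluation.
Context {K : realType} {X Z Y : normedModType K}.

Lemma is_diff_bmlin_eval n (T : X -> bmlin n Z Y) dT x v :
  is_diff x T dT -> is_diff x (fun y => T y v) (fun h => dT h v).
Proof.
move=> dTx; pose e (A : bmlin n Z Y) := A v.
have linE : linear e by [].
pose eM := GRing.isLinear.Build _ _ _ _ _ linE.
pose e' : {linear bmlin n Z Y -> Y} := HB.pack e eM.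
have ec : continuous e'.
  apply: bounded_linear_continuous; apply/linear_boundedP.
  exists (\prod_i `|v i|); split; first exact: num_real.
  move=> r /ltW kr A; rewrite (le_trans (bmlin_norm_le _ _))// mulrC.
  by rewrite -[bmlin_norm A]/`|A| ler_wpM2r.
have de : is_diff (T x) e' e'.
  by constructor; [exact: linear_differentiable|rewrite diff_lin].
exact: (is_diff_comp dTx de).
Qed.

Definition ord_cons n (z : Z) (h : 'I_n -> Z) (i : 'I_n.+1) : Z :=
  oapp h z (unlift ord0 i).

Lemma ord_cons0 n z (h : 'I_n -> Z) : ord_cons z h ord0 = z.
Proof. by rewrite /ord_cons unlift_none. Qed.

Lemma ord_consS n z (h : 'I_n -> Z) i : ord_cons z h (lift ord0 i) = h i.
Proof. by rewrite /ord_cons liftK. Qed.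

Lemma ord_cons_eta0 n z z' (h : 'I_n -> Z) :
  ord_cons z' h = [eta ord_cons z h with ord0 |-> z'].
Proof.
apply/funext => i /=; have [j ->|->] := unliftP ord0 i; last first.
  by rewrite ord_cons0 eqxx.
by rewrite !ord_consS.
Qed.

Lemma ord_cons_etaS n z (h : 'I_n -> Z) i z' :
  ord_cons z [eta h with i |-> z'] =
  [eta ord_cons z h with lift ord0 i |-> z'].
Proof.
apply/funext => j /=; have [k ->|->] := unliftP ord0 j; last first.
  by rewrite !ord_cons0.
by rewrite !ord_consS /= (inj_eq lift_inj).
Qed.

Lemma papp_subproof n (A : bmlin n.+1 Z Y) z :
  (fun h => A (ord_cons z h)) \in @bmlin_pred K n Z Y.
Proof.
apply/asboolP; split=> [i v a u w|].
  by rewrite !ord_cons_etaS bmlin_multilinear.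
exists (`|A| * `|z|) => v; rewrite (le_trans (bmlin_norm_le _ _))//.
rewrite big_ord_recl ord_cons0 mulrA ler_wpM2l ?mulr_ge0 ?bmlin_norm_ge0//.
by apply: ler_prod => i _; rewrite normr_ge0 ord_consS lexx.
Qed.

Definition papp n (A : bmlin n.+1 Z Y) z : bmlin n Z Y := Bmlin (papp_subproof A z).

Lemma pappE n (A : bmlin n.+1 Z Y) z h : papp A z h = A (ord_cons z h).
Proof. by []. Qed.

Lemma papp_contractive n : contractive_bilinear (@papp n).
Proof.
split=> [z a A B|A a z w|A z].
- exact/val_inj/funext.
- apply/val_inj/funext => h.
  rewrite -[RHS]/(a *: A (ord_cons z h) + A (ord_cons w h)) /=.
  have E t := ord_cons_eta0 0 t h.
  rewrite (E z) (E w) (E (a *: z + w)); exact: bmlin_multilinear.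
- apply: bmlin_norm_ub => v v1.
  rewrite pappE (le_trans (bmlin_norm_le _ _))// big_ord_recl ord_cons0.
  rewrite ler_wpM2l ?bmlin_norm_ge0// ler_piMr//.
  by apply: prodr_ile1 => i _; rewrite normr_ge0 ord_consS v1.
Qed.

Lemma bmlin1_app_contractive :
  contractive_bilinear (fun (A : bmlin 1 Z Y) z => A (fun=> z)).
Proof.
split=> [z a A B|A a z w|A z] //.
- have E t : (fun=> t) = [eta (fun=> 0) with ord0 |-> t] :> ('I_1 -> Z).
    by apply/funext => i; rewrite /= ord1.
  by rewrite (E z) (E w) (E (_ + _)) bmlin_multilinear.
- by rewrite (le_trans (bmlin_norm_le _ _))// big_ord1.
Qed.

(** Undoes the uncurrying in [Dn], so that the chain rule for [Dn n f] composed with a map produces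
    a contractive bilinear expression. *)
Lemma diff_Dn n (f : Z -> Y) z w : differentiable (Dn n f) z ->
  'd (Dn n f) z w = papp (Dn n.+1 f z) w :> bmlin n Z Y.
Proof.
move=> df; apply/val_inj/funext => h.
rewrite -[RHS]/(Dn n.+1 f z (ord_cons w h)) DnSE// ord_cons0; congr bmlin_fun.
by apply/funext => i /=; rewrite ord_consS.
Qed.

End BoundedMultilinearEvaluation.

(** * Bounds on iterated directional derivatives *)

Section DirectionalDerivatives.
Context {K : realType} {X : normedModType K}.

(** The head of the list is the direction differentiated last, so inductions that change [f] itself
    peel directions off at the end of the list. *)
Fixpoint dd {Y : normedModType K} (vs : seq X) (f : X -> Y) : X -> Y :=
  if vs is v :: vs' then fun x => 'd (dd vs' f) x v else f.

Lemma dd_cat (Y : normedModType K) vs ws (f : X -> Y) :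
  dd (vs ++ ws) f = dd vs (dd ws f).
Proof. by elim: vs => //= v vs ->. Qed.

Lemma dd_rcons (Y : normedModType K) vs v (f : X -> Y) :
  dd (rcons vs v) f = dd vs (fun x => 'd f x v).
Proof. by rewrite -cats1 dd_cat. Qed.

Definition unit_seq (vs : seq X) := all (fun v => `|v| <= 1) vs.

Context (O : set X) (oO : open O).

Definition differentiable_upto {Y : normedModType K} (N : nat) (f : X -> Y) :=
  forall vs x, (size vs < N)%N -> unit_seq vs -> O x -> differentiable (dd vs f) x.

(** Bounds are asked up to order [N], differentiability only of the derivatives of order below [N],
    which makes those of order [N] genuine derivatives. *)
Definition derivatives_le {Y : normedModType K} (N : nat) (a : nat -> K)
    (f : X -> Y) : Prop :=
  differentiable_upto N f /\
  forall vs x, (size vs <= N)%N -> unit_seq vs -> O x ->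
    `|dd vs f x| <= a (size vs).

Section Closure.
Context {Y : normedModType K}.
Implicit Types (f g : X -> Y) (a b : nat -> K).

Lemma derivatives_le0 a f :
  (forall x, O x -> `|f x| <= a 0) <-> derivatives_le 0 a f.
Proof.
split=> [fa|[_ fa] x Ox]; last exact: (fa [::]).
by split=> [//|[|//] x _ _ /fa].
Qed.

(** Splits off the direction differentiated first; this is the induction principle behind the
    closure properties below. *)
Lemma derivatives_leS N a f : derivatives_le N.+1 a f <->
  (forall x, O x -> differentiable f x /\ `|f x| <= a 0) /\
  (forall v, `|v| <= 1 -> derivatives_le N (a \o S) (fun x => 'd f x v)).
Proof.
split=> [[df fa]|[f0 fS]].
  split=> [x Ox|v v1]; first by split; [exact: (df [::])|exact: (fa [::])].
  split=> vs x; rewrite -dd_rcons => sN vs1 Ox.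
    by apply: df => //; rewrite ?size_rcons// /unit_seq all_rcons v1.
  by rewrite /= -(size_rcons vs v) fa// ?size_rcons// /unit_seq all_rcons v1.
split=> vs x.
  case/lastP: vs => [_ _ /f0[]//|vs v]; rewrite size_rcons /unit_seq all_rcons.
  rewrite ltnS dd_rcons => sN /andP[/fS[df _] vs1]; exact: df.
case/lastP: vs => [_ _ /f0[]//|vs v]; rewrite size_rcons /unit_seq all_rcons.
rewrite ltnS dd_rcons => sN /andP[/fS[_ fa] vs1]; exact: fa.
Qed.

Lemma derivatives_le_order M N a f : (M <= N)%N ->
  derivatives_le N a f -> derivatives_le M a f.
Proof.
move=> MN [df fa]; split=> vs x sM; first by apply: df; exact: leq_trans MN.
by apply: fa; exact: leq_trans MN.
Qed.

Lemma derivatives_le_bound N a b f : (forall n, (n <= N)%N -> a n <= b n) ->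
  derivatives_le N a f -> derivatives_le N b f.
Proof.
by move=> ab [df fa]; split=> // vs x sN vs1 Ox; rewrite (le_trans (fa _ _ _ _ _))// ab.
Qed.

Lemma dd_eq N f g vs x : {in O, f =1 g} -> differentiable_upto N f ->
  (size vs <= N)%N -> unit_seq vs -> O x -> dd vs f x = dd vs g x.
Proof.
move=> fg df; elim: vs x => [x _ _ Ox|v vs IH x /= sN /andP[v1 vs1] Ox].
  by rewrite /= fg// inE.
have E : {in O, dd vs f =1 dd vs g}.
  by move=> y; rewrite inE => Oy; rewrite IH// ltnW.
by rewrite (open_eq_diff oO Ox E)//; exact: df.
Qed.

Lemma derivatives_le_eq N a f g : {in O, f =1 g} ->
  derivatives_le N a f -> derivatives_le N a g.
Proof.
move=> fg [df fa]; split=> vs x sN vs1 Ox; last first.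
  by rewrite -(dd_eq fg df)// fa.
apply: (open_eq_differentiable oO Ox _ (df _ _ sN vs1 Ox)) => y.
by rewrite inE => Oy; rewrite (dd_eq fg df)// ltnW.
Qed.

Lemma derivatives_leD N a b f g :
  derivatives_le N a f -> derivatives_le N b g ->
  derivatives_le N (a \+ b) (f \+ g).
Proof.
elim: N a b f g => [|N IH] a b f g.
  move=> /derivatives_le0 fa /derivatives_le0 gb; apply/derivatives_le0 => x Ox.
  by rewrite (le_trans (ler_normD _ _))// lerD ?fa ?gb.
move=> /derivatives_leS[f0 fS] /derivatives_leS[g0 gS]; apply/derivatives_leS.
split=> [x Ox|v v1].
  have [[df fa] [dg gb]] := (f0 x Ox, g0 x Ox).
  split; first exact: differentiableD.
  by rewrite (le_trans (ler_normD _ _))// lerD.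
apply: derivatives_le_eq (IH _ _ _ _ (fS v v1) (gS v v1)) => x; rewrite inE => Ox.
by rewrite /= diffD//; [have [] := f0 x Ox|have [] := g0 x Ox].
Qed.

Lemma derivatives_le_cst0 N a : (forall n, (n <= N)%N -> 0 <= a n) ->
  derivatives_le N a (fun=> 0 : Y).
Proof.
elim: N a => [|N IH] a a0.
  by apply/derivatives_le0 => x _; rewrite normr0 a0.
apply/derivatives_leS; split=> [x Ox|v v1].
  by rewrite normr0 a0//; split=> //; exact: differentiable_cst.
apply: derivatives_le_eq (IH (a \o S) _) => [x _|n nN]; last exact: a0.
by rewrite (diff_cst (0 : Y)).
Qed.

Lemma derivatives_le_dd N a f vs : derivatives_le N a f -> unit_seq vs ->
  (size vs <= N)%N ->
  derivatives_le (N - size vs) (fun j => a (j + size vs)%N) (dd vs f).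
Proof.
move=> [df fa] vs1 sN; split=> ws x sw ws1 Ox; rewrite -dd_cat.
  apply: df => //; first by rewrite size_cat; lia.
  by rewrite /unit_seq all_cat; apply/andP.
rewrite -size_cat; apply: fa => //; first by rewrite size_cat; lia.
by rewrite /unit_seq all_cat; apply/andP.
Qed.

End Closure.
End DirectionalDerivatives.

(* [\sum_i 'C(n, i) a_i b_(n - i)], by the recursion that mirrors the Leibniz rule *)
Fixpoint binconv {K : realType} (n : nat) (a b : nat -> K) : K :=
  if n is m.+1 then binconv m (a \o S) b + binconv m a (b \o S) else a 0 * b 0.

Section Leibniz.
Context {K : realType} {X U V W : normedModType K}.
Context (O : set X) (oO : open O) (B : U -> V -> W) (Bb : contractive_bilinear B).
Implicit Types (f : X -> U) (g : X -> V) (a b : nat -> K).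

(** One derivative turns [B f g] into a sum of two expressions of the same kind, which correspond to
    the two summands in the recursion of [binconv]. *)
Lemma derivatives_le_bilinear N a b f g :
  derivatives_le O N a f -> derivatives_le O N b g ->
  derivatives_le O N (fun n => binconv n a b) (fun x => B (f x) (g x)).
Proof.
have [_ _ Bn] := Bb.
elim: N a b f g => [|N IH] a b f g.
  move=> /derivatives_le0 fa /derivatives_le0 gb; apply/derivatives_le0 => x Ox.
  by rewrite (le_trans (Bn _ _))//= ler_pM ?fa ?gb.
move=> /[dup] fN /derivatives_leS[f0 fS] /[dup] gN /derivatives_leS[g0 gS].
have dB x : O x -> is_diff x (fun y => B (f y) (g y))
    (fun h => B ('d f x h) (g x) + B (f x) ('d g x h)).
  move=> Ox; have [[df _] [dg _]] := (f0 x Ox, g0 x Ox).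
  by apply: is_diff_contractive_bilinear => //; apply/differentiableP.
apply/derivatives_leS; split=> [x Ox|v v1].
  have [[_ fa] [_ gb]] := (f0 x Ox, g0 x Ox).
  split; first by have [] := dB x Ox.
  by rewrite (le_trans (Bn _ _))//= ler_pM.
have fN' := derivatives_le_order (leqnSn N) fN.
have gN' := derivatives_le_order (leqnSn N) gN.
have := derivatives_leD oO (IH _ _ _ _ (fS v v1) gN') (IH _ _ _ _ fN' (gS v v1)).
apply: (derivatives_le_eq oO) => x; rewrite inE => Ox.
by have [_ ->] := dB x Ox.
Qed.

(* [leibniz_rest ws f g] collects the terms of [dd ws (B f g)] other than
   [B f (dd ws g)]; it involves only derivatives of [g] of lower order. *)
Fixpoint leibniz_rest (ws : seq X) f g : X -> W :=
  if ws is w :: ws' then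
    fun x => B ('d f x w) (dd ws' g x) + 'd (leibniz_rest ws' f g) x w
  else fun=> 0.

(** Derivatives of order [j] of the rest are those of order [j + size ws] of [B f g] without those
    of order [j] of [B f (dd ws g)]. The bounds subtract accordingly, since they contain one term
    for each Leibniz term. For [j = 0] the bound on the top derivative of [g] cancels, so [g] may be
    controlled to one order less than [f]. *)
Lemma derivatives_le_leibniz_rest M N a b f g ws : (M <= N.+1)%N ->
  derivatives_le O M a f -> derivatives_le O N b g ->
  unit_seq ws -> (size ws <= M)%N ->
  derivatives_le O (M - size ws)
    (fun j => binconv (j + size ws) a b - binconv j a (fun i => b (i + size ws)%N))
    (leibniz_rest ws f g).
Proof.
move=> MN fa gb; elim: ws => [_ _|w ws IH /= /andP[w1 ws1] sM].
  rewrite subn0; apply: derivatives_le_cst0 => // n _.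
  rewrite addn0 (_ : (fun i => b _) = b) ?subrr//.
  by apply/funext => i; rewrite addn0.
have := IH ws1 (ltnW sM).
have [k Mk] : exists k, M = (size ws + k.+1)%N by exists (M - (size ws).+1)%N; lia.
have -> : (M - size ws = k.+1)%N by lia.
have -> : (M - (size ws).+1 = k)%N by lia.
move=> /derivatives_leS[_ /(_ w w1) rS].
have {}fa : derivatives_le O k (a \o S) (fun x => 'd f x w).
  have : derivatives_le O k.+1 a f by apply: derivatives_le_order fa; lia.
  by move=> /derivatives_leS[_]; apply.
have {}gb : derivatives_le O k (fun i => b (i + size ws)%N) (dd ws g).
  have sN : (size ws <= N)%N by lia.
  by apply: derivatives_le_order (derivatives_le_dd gb ws1 sN); lia.
have := derivatives_leD oO (derivatives_le_bilinear fa gb) rS.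
apply: derivatives_le_bound => n _; rewrite [leLHS]/=.
(* By the recursion of [binconv], [p] is also the first half of the subtracted term in the bound of
   [rS]; it cancels, and the second half has its shift increased by one. *)
set p := binconv n (a \o S) _.
rewrite (_ : (fun i => b (i + _)) \o S = fun i => b (i + (size ws).+1)%N).
  by rewrite addnS /=; lra.
by apply/funext => i /=; rewrite -addSnnS.
Qed.

(** If [size ws = N.+1], no bound on [dd ws g] is at hand; differentiability of [g] below that order
    suffices to isolate this term. *)
Lemma dd_bilinear M N a b f g ws x : (M <= N.+1)%N ->
  derivatives_le O M a f -> derivatives_le O N b g ->
  unit_seq ws -> (size ws <= M)%N -> differentiable_upto O (size ws) g -> O x ->
  dd ws (fun x => B (f x) (g x)) x = B (f x) (dd ws g x) + leibniz_rest ws f g x.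
Proof.
move=> MN fa gb; elim: ws x => [|w ws IH] x; first by rewrite addr0.
move=> /= /andP[w1 ws1] sM dg Ox.
have {}IH : {in O, (fun y => B (f y) (dd ws g y) + leibniz_rest ws f g y) =1
    dd ws (fun x => B (f x) (g x))}.
  move=> y; rewrite inE => Oy; rewrite IH ?(ltnW sM)//.
  by move=> vs z sv; apply: dg; exact: ltnW.
have df : differentiable f x by apply: (fa.1 [::]) => //; exact: leq_ltn_trans sM.
have dgx : differentiable (dd ws g) x by exact: dg.
have dr : differentiable (leibniz_rest ws f g) x.
  have [+ _] := derivatives_le_leibniz_rest MN fa gb ws1 (ltnW sM).
  by move=> /(_ [::] x); apply; rewrite // subn_gt0.
have dB := is_diff_contractive_bilinear Bb (differentiableP df) (differentiableP dgx).
have [_ ->] := open_eq_is_diff oO Ox IH (is_diffD dB (differentiableP dr)).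
by rewrite !fctE addrA [X in X + _]addrC.
Qed.

End Leibniz.

Section Pairing.
Context {K : realType} {X U V : normedModType K} (O : set X) (oO : open O).
Implicit Types (f : X -> U) (g : X -> V).

Lemma dd_pair f g ws x : differentiable_upto O (size ws) f ->
  differentiable_upto O (size ws) g -> unit_seq ws -> O x ->
  dd ws (fun y => (f y, g y)) x = (dd ws f x, dd ws g x).
Proof.
elim: ws x => [//|w ws IH] x df dg /= /andP[w1 ws1] Ox.
have {}IH : {in O, (fun y => (dd ws f y, dd ws g y)) =1
    dd ws (fun y => (f y, g y))}.
  by move=> y; rewrite inE => Oy; rewrite IH// => vs z sv;
    [apply: df|apply: dg]; exact: ltnW.
have dfx : differentiable (dd ws f) x by exact: df.
have dgx : differentiable (dd ws g) x by exact: dg.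
by rewrite -(open_eq_diff oO Ox IH) ?diff_pair//; exact: differentiable_pair.
Qed.

Lemma derivatives_le_pair N a f g : derivatives_le O N a f ->
  derivatives_le O N a g -> derivatives_le O N a (fun x => (f x, g x)).
Proof.
move=> [df fa] [dg ga].
have E vs x : (size vs <= N)%N -> unit_seq vs -> O x ->
    dd vs (fun y => (f y, g y)) x = (dd vs f x, dd vs g x).
  by move=> sN vs1 Ox; apply: dd_pair => // ws z sw; [apply: df|apply: dg];
    exact: leq_trans sN.
split=> vs x sN vs1 Ox; last first.
  by rewrite E// prod_normE/= ge_max fa ?ga.
apply: (@open_eq_differentiable _ _ _ (fun y => (dd vs f y, dd vs g y)) _ _ O) => //.
  by move=> y; rewrite inE => Oy; rewrite E// ltnW.
by apply: differentiable_pair; [exact: df|exact: dg].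
Qed.

Lemma dd_cst ws (v : V) : dd ws (fun=> v) = fun _ : X => if ws is [::] then v else 0.
Proof.
elim: ws => [//|w ws /= ->]; apply/funext => x.
by rewrite (diff_cst (if ws is [::] then v else 0)).
Qed.

Lemma derivatives_le_cst N a (v : V) : `|v| <= a 0 ->
  (forall n, 0 <= a n) -> derivatives_le O N a (fun=> v).
Proof.
move=> va a0; split=> vs x _ _ _; rewrite dd_cst; first exact: differentiable_cst.
by case: vs => //= *; rewrite normr0.
Qed.

End Pairing.

Section Composition.
Context {K : realType} {X Z Y : normedModType K} (O : set X) (oO : open O).

Lemma is_diff_Dn1 (f : Z -> Y) z : differentiable (Dn 0 f) z ->
  is_diff z f (fun w => Dn 1 f z (fun=> w)).
Proof.
move=> df; have := is_diff_bmlin_eval (fun=> 0) (differentiableP df).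
have -> : (fun y => Dn 0 f y (fun=> 0)) = f by apply/funext => y; rewrite Dn0E.
move=> [? E]; constructor=> //; rewrite E; apply/funext => w.
by rewrite DnSE//; congr bmlin_fun; apply/funext => -[].
Qed.

(** Replaces the Faa di Bruno formula: the derivative of [Dn k f] along [P] is [papp] of [Dn k.+1 f]
    along [P] and of the derivative of [P], so the Leibniz bound and an induction on [m] for all [k]
    at once suffice. [L] caps the total order, and [sigma n] belongs to the derivative of order
    [n.+1] of [P]. *)
Lemma derivatives_le_Dn_comp (f : Z -> Y) (P : X -> Z) (c : nat -> nat -> K)
    (sigma : nat -> K) N L m k :
  (forall x, O x -> differentiable P x) ->
  (forall x n, O x -> differentiable (Dn n f) (P x)) ->
  (forall x n, O x -> (n < L)%N -> `|Dn n f (P x)| <= c n 0) ->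
  (forall v, `|v| <= 1 -> derivatives_le O N sigma (fun x => 'd P x v)) ->
  (forall i n, (i + n.+1 < L)%N -> binconv n (c i.+1) sigma <= c i n.+1) ->
  (m <= N.+1)%N -> (k + m < L)%N ->
  derivatives_le O m (c k) (fun x => Dn k f (P x)).
Proof.
move=> dP df fc Psigma cS; elim: m k => [|m IH] k mN kL.
  by apply/derivatives_le0 => x Ox; rewrite fc//; lia.
have dfP x : O x -> is_diff x (Dn k f \o P)
    ('d (Dn k f) (P x) \o 'd P x).
  by move=> Ox; apply: is_diff_comp; apply/differentiableP; auto.
apply/derivatives_leS; split=> [x Ox|v v1].
  by split; [have [] := dfP x Ox|rewrite fc//; lia].
have kS : derivatives_le O m (c k.+1) (fun x => Dn k.+1 f (P x)).
  by apply: IH; lia.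
have mN' : (m <= N)%N by [].
have H := derivatives_le_bilinear oO (papp_contractive k) kS
  (derivatives_le_order mN' (Psigma v v1)).
have {}H := @derivatives_le_bound _ _ _ _ _ _ (c k \o S) _ _ H.
apply: derivatives_le_eq (H _) => // [x|n nm]; last by apply: cS; lia.
rewrite inE => Ox; have [_ E] := dfP x Ox.
transitivity (papp (Dn k.+1 f (P x)) ('d P x v)) => //.
by rewrite -diff_Dn ?E//; exact: df.
Qed.

End Composition.

(** * Implicit differentiation of the solution map *)

Section ImplicitSolution.
Context {K : realType} {X V Y : normedModType K} (O : set X) (oO : open O).
Context (R : X * V -> Y) (S : X -> V) (alpha : K) (a0 : 0 < alpha).
Hypothesis dR : forall n x, O x -> differentiable (Dn n R) (x, S x).
Hypothesis RS0 : forall x, O x -> R (x, S x) = 0.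
Hypothesis cS : forall x, O x -> {for x, continuous S}.
Hypothesis invR : forall x, O x -> exists M : Y -> V,
  [/\ linear M, forall w, `|M w| <= alpha * `|w|
    & forall v, M ('d R (x, S x) (0, v)) = v].

Let P x := (x, S x).
Let G x := Dn 1 R (P x).
Let ev (A : bmlin 1 (X * V)%type Y) z := A (fun=> z).

Let dR0 x : O x -> is_diff (P x) R (ev (G x)).
Proof. by move=> Ox; apply: is_diff_Dn1; exact: dR. Qed.

Lemma solution_differentiable x : O x -> differentiable S x.
Proof.
move=> Ox; have [M [linM Ma MR]] := invR Ox.
have [dRx _] := dR0 Ox.
have nR : \forall y \near x, R (y, S y) = 0.
  by apply: filterS (open_nbhs_nbhs (conj oO Ox)) => y; exact: RS0.
by have [] := implicit_is_diff a0 dRx (cS Ox) nR linM Ma MR.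
Qed.

Let dP x : O x -> is_diff x P (fun h => (h, 'd S x h)).
Proof.
move=> Ox; apply: is_diff_pair.
exact/differentiableP/solution_differentiable.
Qed.

Let dP_eq v : {in O, (fun y => (v, 'd S y v)) =1 (fun y => 'd P y v)}.
Proof. by move=> y; rewrite inE => Oy; have [_ ->] := dP Oy. Qed.

Lemma ev_diff_solution x v : O x -> ev (G x) (v, 'd S x v) = 0.
Proof.
move=> Ox; have := is_diff_comp (dP Ox) (dR0 Ox).
move=> /(open_eq_is_diff (g := cst 0) oO Ox) H.
have [|_] := H _; first by move=> y; rewrite inE => /RS0.
by rewrite diff_cst => /(congr1 (@^~ v)) /= <-.
Qed.

Lemma norm_le_solution_op x v : O x -> `|v| <= alpha * `|ev (G x) (0, v)|.
Proof.
move=> Ox; have [M [_ Ma MR]] := invR Ox.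
by rewrite -{1}[v]MR; have [_ ->] := dR0 Ox.
Qed.

(** Base of the recursion: by linearity the once differentiated equation says that [G x] maps
    [(0, 'd S x v)] to the opposite of its value at [(v, 0)]. *)
Lemma norm_diff_solution x v : O x -> `|'d S x v| <= alpha * `|G x| * `|v|.
Proof.
move=> Ox; rewrite (le_trans (norm_le_solution_op _ Ox))// -mulrA ler_wpM2l ?(ltW a0)//.
have [_ evlin evn] := @bmlin1_app_contractive K (X * V)%type Y.
have E : (v, 'd S x v) = 1 *: (0, 'd S x v) + (v, 0).
  by congr pair; rewrite /= scale1r ?add0r ?addr0.
have -> : ev (G x) (0, 'd S x v) = - ev (G x) (v, 0).
  apply/eqP; rewrite -addr_eq0 -[X in X + _]scale1r -[X in X == _]evlin -E.
  by rewrite -[X in X == _]/(ev (G x) (v, 'd S x v)) ev_diff_solution.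
rewrite normrN (le_trans (evn _ _))//.
by rewrite prod_normE/= normr0 max_l.
Qed.

Section Step.
Context (tau : nat -> K) (c1 : nat -> K) (n : nat).
Hypothesis tau1 : 1 <= tau 1.
Hypothesis tau0 : forall i, 0 <= tau i.
Hypothesis Gc : derivatives_le O n.+1 c1 G.
Hypothesis dSn : forall v, `|v| <= 1 ->
  derivatives_le O n (tau \o succn) (fun x => 'd S x v).

(** First component of the derivative along [ws] of [x |-> (v, 'd S x v)]. *)
Let W (v : X) (ws : seq X) : X := if ws is [::] then v else 0.

(** In the maximum norm the constant component [v] costs nothing, because |v| <= 1 <= [tau 1]. *)
Lemma derivatives_le_diff_graph v : `|v| <= 1 ->
  derivatives_le O n (tau \o succn) (fun x => 'd P x v).
Proof.
move=> v1; apply: (derivatives_le_eq oO (dP_eq v)).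
apply: (derivatives_le_pair oO _ (dSn v1)).
by apply: derivatives_le_cst => //=; exact: le_trans tau1.
Qed.

(** Leibniz rule for [ev_diff_solution] along [ws], with the top derivative of [S] isolated. Length
    [n] serves to prove differentiability, length [n.+1] to prove the bound. *)
Let solution_eq v ws x : `|v| <= 1 -> unit_seq ws -> (size ws <= n.+1)%N ->
  differentiable_upto O (size ws) (fun x => 'd S x v) -> O x ->
  ev (G x) (W v ws, dd ws (fun x => 'd S x v) x) +
    leibniz_rest ev ws G (fun x => (v, 'd S x v)) x = 0.
Proof.
move=> v1 ws1 sw dS Ox.
have dcst : differentiable_upto O (size ws) (fun=> v).
  by move=> vs z _ _ _; rewrite dd_cst; exact: differentiable_cst.
have dPn : derivatives_le O n (tau \o succn) (fun x => (v, 'd S x v)).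
  apply: (derivatives_le_pair oO _ (dSn v1)).
  by apply: derivatives_le_cst => //=; exact: le_trans tau1.
have dPw : differentiable_upto O (size ws) (fun x => (v, 'd S x v)).
  move=> vs z sv vs1 Oz; apply: (@open_eq_differentiable _ _ _
     (fun y => (dd vs (fun=> v) y, dd vs (fun x => 'd S x v) y)) _ _ O) => //.
    move=> y; rewrite inE => Oy; rewrite (dd_pair oO)// => us t su us1 Ot.
      by apply: dcst => //; exact: ltn_trans sv.
    by apply: dS => //; exact: ltn_trans sv.
  by apply: differentiable_pair; [exact: dcst|exact: dS].
have := dd_bilinear oO bmlin1_app_contractive (leqnn _) Gc dPn ws1 sw dPw Ox.
rewrite (dd_pair oO)// dd_cst -/ev => <-.
have -> : dd ws (fun x => ev (G x) (v, 'd S x v)) x = dd ws (fun=> 0) x.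
  apply: esym; apply: (@dd_eq _ _ O oO _ (size ws)) => //.
    by move=> y; rewrite inE => Oy; rewrite ev_diff_solution.
  by move=> vs z _ _ _; rewrite dd_cst; exact: differentiable_cst.
by rewrite dd_cst; case: (ws).
Qed.

Let rest_le v ws : `|v| <= 1 -> unit_seq ws -> (size ws <= n.+1)%N ->
  derivatives_le O (n.+1 - size ws)
    (fun j => binconv (j + size ws) c1 (tau \o succn) -
       binconv j c1 (fun i => tau (i + size ws).+1))
    (leibniz_rest ev ws G (fun x => (v, 'd S x v))).
Proof.
move=> v1 ws1 sw; have dPn : derivatives_le O n (tau \o succn) (fun x => (v, 'd S x v)).
  apply: (derivatives_le_pair oO _ (dSn v1)).
  by apply: derivatives_le_cst => //=; exact: le_trans tau1.
exact: (derivatives_le_leibniz_rest oO bmlin1_app_contractive (leqnn _) Gc dPn).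
Qed.

(** The derivative [u] solves an implicit equation [F (y, u y) = 0], where [F] is affine in its
    second variable with linear part [z |-> ev (G y) (0, z)]. The a priori estimate for this linear
    part yields continuity of [u], and then the left inverse yields differentiability. *)
Lemma solution_dd_differentiable v ws x : `|v| <= 1 -> unit_seq ws ->
  size ws = n -> O x -> differentiable (dd ws (fun x => 'd S x v)) x.
Proof.
move=> v1 ws1 sw Ox; set u := dd ws _.
have [Bl Br Bn] := @bmlin1_app_contractive K (X * V)%type Y.
have dSw : differentiable_upto O (size ws) (fun x => 'd S x v).
  by rewrite sw; have [] := dSn v1.
have sw' : (size ws <= n.+1)%N by rewrite sw.
pose F (p : X * V) := ev (G p.1) (W v ws, p.2) +
  leibniz_rest ev ws G (fun x => (v, 'd S x v)) p.1.
have Fu y : O y -> F (y, u y) = 0 by move=> Oy; exact: solution_eq.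
have fst_diff (p : X * V) : is_diff p fst fst.
  have c (q : X * V) : {for q, continuous (fst : X * V -> _)} by exact: cvg_fst.
  by constructor; [exact: linear_differentiable|rewrite diff_lin].
have snd_diff (p : X * V) : is_diff p snd snd.
  have c (q : X * V) : {for q, continuous (snd : X * V -> _)} by exact: cvg_snd.
  by constructor; [exact: linear_differentiable|rewrite diff_lin].
have dG : differentiable G x by apply: (Gc.1 [::]).
have dr : differentiable (leibniz_rest ev ws G (fun x => (v, 'd S x v))) x.
  by have [+ _] := rest_le v1 ws1 sw'; move=> /(_ [::] x); apply; rewrite // sw subSnn.
have dF : is_diff (x, u x) F (fun h => ev ('d G x h.1) (W v ws, u x) +
    ev (G x) (0, h.2) +
    'd (leibniz_rest ev ws G (fun x => (v, 'd S x v))) x h.1).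
  have d1 : is_diff (x, u x) (G \o fst) ('d G x \o fst).
    by apply: is_diff_comp; exact/differentiableP.
  have d2 : is_diff (x, u x) (fun p : X * V => (W v ws, p.2)) (fun h => (0, h.2)).
    by apply: is_diff_pair; exact: is_diff_cst.
  have d3 : is_diff (x, u x) (leibniz_rest ev ws G (fun x => (v, 'd S x v)) \o fst)
      ('d (leibniz_rest ev ws G (fun x => (v, 'd S x v))) x \o fst).
    by apply: is_diff_comp; exact/differentiableP.
  exact: is_diffD (is_diff_contractive_bilinear bmlin1_app_contractive d1 d2) d3.
have [dFx dFE] := dF.
have [M [linM Ma MR]] := invR Ox.
have MF z : M ('d F (x, u x) (0, z)) = z.
  rewrite dFE /= !linear0 addr0.
  rewrite (_ : ev 0 _ = 0) // add0r -[RHS]MR.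
  by have [_ ->] := dR0 Ox.
have nO : \forall y \near x, O y by exact: open_nbhs_nbhs.
have cu : {for x, continuous u}.
  apply: (implicit_continuous a0 dFx (Fu x Ox)).
  apply: filterS nO => y Oy; split=> [|z]; first exact: Fu.
  rewrite (le_trans (norm_le_solution_op _ Oy))// ler_wpM2l ?(ltW a0)//.
  rewrite /F /= opprD addrACA subrr addr0.
  rewrite (_ : (0, u y - z) = (-1) *: (W v ws, z) + (W v ws, u y)); last first.
    by congr pair; rewrite /= scaleN1r ?addNr// addrC.
  by rewrite [ev (G y) _]Br scaleN1r addrC.
have nF : \forall y \near x, F (y, u y) = 0 by apply: filterS nO => y; exact: Fu.
by have [] := implicit_is_diff a0 dFx cu nF linM Ma MF.
Qed.

(** The subtracted [c1 0 * tau n.+2] is the Leibniz term with the top derivative of [S], which stays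
    on the left-hand side and is estimated through the inverse. *)
Lemma derivatives_le_solution_step :
  alpha * (binconv n.+1 c1 (tau \o succn) - c1 0 * tau n.+2) <= tau n.+2 ->
  forall v, `|v| <= 1 -> derivatives_le O n.+1 (tau \o succn) (fun x => 'd S x v).
Proof.
move=> tau_rec v v1; have [dS Sa] := dSn v1.
have dS' : differentiable_upto O n.+1 (fun x => 'd S x v).
  move=> ws x; rewrite ltnS leq_eqVlt => /orP[/eqP sw|sw] ws1 Ox.
    exact: solution_dd_differentiable.
  exact: dS.
split=> // ws x; rewrite leq_eqVlt => /orP[/eqP sw|sw] ws1 Ox; last exact: Sa.
rewrite sw (le_trans _ tau_rec)//.
rewrite (le_trans (norm_le_solution_op _ Ox))// ler_wpM2l ?(ltW a0)//.
have := @solution_eq v ws x v1 ws1; rewrite sw => /(_ (leqnn _) dS' Ox) /eqP.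
have -> : W v ws = 0 by case: (ws) sw.
rewrite addr_eq0 => /eqP ->; rewrite normrN.
have := rest_le v1 ws1; rewrite sw => /(_ (leqnn _)) [_ /(_ [::] x)].
by rewrite /= => /(_ isT isT Ox).
Qed.

End Step.
End ImplicitSolution.

(** * Majorant sequences *)

Section SchroederPolynomials.
Context {K : realType}.
Implicit Types (p q : {poly K}) (a b r y : K).

Definition nneg_poly p := forall n, 0 <= p`_n.

Lemma nneg_polyM p q : nneg_poly p -> nneg_poly q -> nneg_poly (p * q).
Proof. by move=> p0 q0 n; rewrite coefM sumr_ge0// => i _; rewrite mulr_ge0. Qed.

Lemma nneg_polyX p n : nneg_poly p -> nneg_poly (p ^+ n).
Proof.
move=> p0; elim: n => [|n IH]; last by rewrite exprS; exact: nneg_polyM.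
by move=> k; rewrite expr0 coef1 ler0n.
Qed.

(** Picard iterates, started at 0, of [y = b X + a (y^2 + ... + y^(L-1))]. Truncating
    [y^2 / (1 - y)] keeps them polynomials. *)
Fixpoint schroeder_poly (L : nat) a b (i : nat) : {poly K} :=
  if i is i'.+1 then
    b *: 'X + a *: \sum_(2 <= j < L) schroeder_poly L a b i' ^+ j
  else 0.

Context (L : nat) (a b : K).
Let sp := schroeder_poly L a b.

Lemma schroeder_poly_nneg i : 0 <= a -> 0 <= b -> nneg_poly (sp i).
Proof.
move=> a0 b0; elim: i => [|i IH] n; first by rewrite coef0.
rewrite coefD !coefZ coefX coef_sum addr_ge0// mulr_ge0 ?ler0n//.
by rewrite sumr_ge0// => j _; exact: nneg_polyX.
Qed.

Lemma schroeder_poly_coef0 i : (sp i)`_0 = 0.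
Proof.
elim: i => [|i IH]; first by rewrite coef0.
rewrite coefD !coefZ coefX mulr0 add0r coef_sum big_nat big1 ?mulr0// => j.
by case: j => [//|j] _; rewrite exprS coef0M IH mul0r.
Qed.

(** Consecutive iterates differ by a multiple of ['X^(i.+1)]: the difference of two powers of
    exponent at least 2 is the difference of the bases times a sum divisible by ['X], so each
    iteration gains one factor. *)
Lemma schroeder_poly_stable i n : (n <= i)%N -> (sp i.+1)`_n = (sp i)`_n.
Proof.
have dX k : 'X %| sp k.
  by rewrite -['X]subr0 dvdp_XsubCl /root horner_coef0 schroeder_poly_coef0.
suff /dvdpP[q E] : 'X^(i.+1) %| sp i.+1 - sp i.
  move=> ni; apply/eqP; rewrite -subr_eq0 -coefB E coefMXn ltnS ni.
  by rewrite eqxx.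
have dvd_sum (q : {poly K}) m n' (F : nat -> {poly K}) :
    (forall j, (m <= j)%N -> q %| F j) -> q %| \sum_(m <= j < n') F j.
  move=> qF; rewrite big_nat; apply: (big_ind (fun p => q %| p)).
  - exact: dvdp0.
  - by move=> p1 p2; exact: dvdp_add.
  - by move=> j /andP[/qF].
elim: i => [|i IH].
  rewrite subr0 /sp /= big_nat big1 => [|j]; last by case: j => [//|j] _; rewrite expr0n.
  by rewrite scaler0 addr0 -mul_polyC expr1 dvdp_mull.
have -> : sp i.+2 - sp i.+1 = a *: \sum_(2 <= j < L) (sp i.+1 ^+ j - sp i ^+ j).
  by rewrite sumrB scalerBr opprD addrACA subrr add0r.
rewrite -mul_polyC; apply/dvdp_mull/dvd_sum => j j2.
rewrite subrXX exprSr dvdp_mul//.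
apply: (big_ind (fun p => 'X %| p)) => [|p1 p2|k _].
- exact: dvdp0.
- exact: dvdp_add.
case: (posnP k) => [->|k0]; last by rewrite dvdp_mull// -(prednK k0) exprS dvdp_mulr.
by rewrite dvdp_mulr// subn0 -(subnK j2) addn2 /= exprS dvdp_mulr.
Qed.

Lemma schroeder_poly_coef1 i : (sp i.+1)`_1 = b.
Proof.
elim: i => [|i <-]; last by rewrite schroeder_poly_stable.
rewrite coefD !coefZ coefX mulr1 big_nat big1 => [|j].
  by rewrite coef0 mulr0 addr0.
by case: j => [//|j] _; rewrite expr0n.
Qed.

Lemma schroeder_poly_rec i n : (1 < n <= i)%N ->
  a * (\sum_(2 <= j < L) sp i ^+ j)`_n = (sp i)`_n.
Proof.
move=> /andP[n1 ni]; rewrite -(schroeder_poly_stable ni) /= coefD !coefZ coefX.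
by rewrite gtn_eqF// mulr0 add0r.
Qed.

(** The iteration is monotone on nonnegative numbers, hence stays below any supersolution [y]. *)
Lemma schroeder_poly_horner_le i r y : 0 <= a -> 0 <= b -> 0 <= r -> 0 <= y < 1 ->
  b * r + a * (y ^+ 2 / (1 - y)) <= y -> 0 <= (sp i).[r] <= y.
Proof.
move=> a0 b0 r0 /andP[y0 y1] rec; elim: i => [|i /andP[IH0 IH]].
  by rewrite horner0 lexx.
rewrite hornerD !hornerZ hornerX horner_sum.
have S0 : 0 <= \sum_(2 <= j < L) (sp i ^+ j).[r].
  by apply: sumr_ge0 => j _; rewrite horner_exp exprn_ge0.
apply/andP; split; first by rewrite addr_ge0 ?mulr_ge0.
rewrite (le_trans _ rec)// lerD2l ler_wpM2l//.
apply: (@le_trans _ _ (\sum_(2 <= j < L) y ^+ j)).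
  by apply: ler_sum => j _; rewrite horner_exp lerXn2r.
rewrite ler_pdivlMr ?subr_gt0//.
have [L2|/ltnW L2] := leqP 2 L; last by rewrite big_geq// mul0r exprn_ge0.
suff -> : (\sum_(2 <= j < L) y ^+ j) * (1 - y) = y ^+ 2 - y ^+ L.
  by rewrite gerBl exprn_ge0.
elim: L L2 => [//|l IHl]; rewrite leq_eqVlt => /orP[/eqP <-|l2].
  by rewrite big_geq// mul0r subrr.
rewrite big_nat_recr//= mulrDl IHl// (exprSr y l); ring.
Qed.

(** All terms of the value at [r] are nonnegative, they sum to at most [2 * (b * r)], and the linear
    one is [b * r]; any other term is therefore at most [b * r]. *)
Lemma schroeder_poly_coef_le i n r y : 0 <= a -> 0 <= b -> 0 < r -> 0 <= y < 1 ->
  b * r + a * (y ^+ 2 / (1 - y)) <= y -> y <= 2 * (b * r) -> (0 < n <= i)%N ->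
  (sp i)`_n * r ^+ n <= b * r.
Proof.
move=> a0 b0 r0 y01 rec y2 /andP[n0 ni].
case: i ni => [|i] ni; first by move: n0; rewrite lt0n -leqn0 ni.
have [->|n1] := eqVneq n 1%N; first by rewrite schroeder_poly_coef1.
have := schroeder_poly_horner_le i.+1 a0 b0 (ltW r0) y01 rec.
move=> /andP[_ /le_trans/(_ y2)].
have sp0 := schroeder_poly_nneg i.+1 a0 b0.
have tge0 k : 0 <= (sp i.+1)`_k * r ^+ k by rewrite mulr_ge0 ?sp0 ?exprn_ge0 ?ltW.
pose m := (maxn (size (sp i.+1)) n.+1).
rewrite (@horner_coef_wide _ m); last by rewrite leq_maxl.
have n_lt : (n < m)%N by rewrite leq_maxr.
have m1 : (1 < m)%N by apply: leq_trans n_lt.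
rewrite (bigD1 (Ordinal n_lt))//= (bigD1 (Ordinal m1))//=; last first.
  by rewrite -val_eqE /= eq_sym.
rewrite schroeder_poly_coef1 expr1.
set T := \sum_(_ | _) _; have T0 : 0 <= T by apply: sumr_ge0.
by lra.
Qed.

End SchroederPolynomials.

(** The gain of one over the factorial of the sum [m.+1 + n.+1] makes up for the increase of [k] by
    one in each application of the chain rule. *)
Lemma fact_mul_le m n : (m.+1`! * n.+1`! <= (m + n).+1`!)%N.
Proof.
elim: n => [|n IH]; first by rewrite muln1 addn0.
rewrite addnS [in leqLHS]factS [in leqRHS]factS mulnCA leq_mul//; lia.
Qed.

Lemma binconv_sum {K : realType} n (a b : nat -> K) :
  binconv n a b =
  n`!%:R * \sum_(i < n.+1) (a i / i`!%:R) * (b (n - i)%N / (n - i)`!%:R).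
Proof.
have f0 k : k`!%:R != 0 :> K by rewrite pnatr_eq0 -lt0n fact_gt0.
have fS (c : nat -> K) k : c k.+1 / k`!%:R = k.+1%:R * (c k.+1 / k.+1`!%:R).
  rewrite factS natrM; field.
  by rewrite f0 addrC natr1 pnatr_eq0.
elim: n a b => [|n IH] a b; first by rewrite big_ord1 /= !divr1 mul1r.
rewrite /= !IH -mulrDr factS natrM [_ * n`!%:R]mulrC -mulrA; congr (_ * _).
pose t i := (a i / i`!%:R) * (b (n.+1 - i)%N / (n.+1 - i)`!%:R).
(* The factor [n.+1] is split as [i + (n.+1 - i)]; the two parts are the two summands in the
   recursion of [binconv]. *)
transitivity (\sum_(i < n.+2) i%:R * t i + \sum_(i < n.+2) (n.+1 - i)%:R * t i).
  congr (_ + _).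
    rewrite [RHS]big_ord_recl mul0r add0r; apply: eq_bigr => i _.
    by rewrite /t lift0 /= (fS a) subSS -mulrA.
  rewrite [RHS]big_ord_recr /= subnn mul0r addr0; apply: eq_bigr => i _.
  have ni : (i <= n)%N by rewrite -ltnS.
  by rewrite /t subSn//= (fS b) !mulrA [_ * (n - i).+1%:R]mulrC !mulrA.
rewrite -big_split mulr_sumr; apply: eq_bigr => i _ /=.
by rewrite -mulrDl -natrD subnKC// -ltnS.
Qed.

Section GevreyMajorant.
Context {K : realType} (s alpha vsig dig : K) (N : nat).
Hypotheses (s1 : 1 <= s) (alpha1 : 1 <= alpha) (vsig1 : 1 <= vsig) (dig1 : 1 <= dig).

(** Up to the weights [w], which carry the excess of [s] over 1, [p / dig] is the exponential
    generating function of the bounds on [S]. [geom] truncates [1 / (1 - X)], and [vsig * dig^k]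
    times [Phi k] plays the same part for [D^k R] along the graph. *)
Let L := N.+3.
Let a := alpha * vsig * dig.
Let b := a * dig.
Let p : {poly K} := schroeder_poly L a b N.
Let geom : {poly K} := \poly_(j < L) 1.
Let Phi k : {poly K} := geom^`(k) \Po p.
Let w n : K := n`!%:R `^ (s - 1).

(* [gevrey_inner n] bounds the [n]-th derivative of [d |-> (d, S d)] for
   [0 < n <= N], [gevrey_outer k n] that of [d |-> D^k R (d, S d)]. *)
Definition gevrey_inner n : K := w n * n`!%:R * p`_n / dig.
Definition gevrey_outer k n : K :=
  w (k + n) * n`!%:R * vsig * dig ^+ k * (Phi k)`_n.

Let dig0 : 0 < dig. Proof. exact: lt_le_trans dig1. Qed.
Let vsig0 : 0 < vsig. Proof. exact: lt_le_trans vsig1. Qed.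
Let alpha0 : 0 < alpha. Proof. exact: lt_le_trans alpha1. Qed.
Let a0 : 0 < a. Proof. by rewrite !mulr_gt0. Qed.
Let b0 : 0 < b. Proof. by rewrite mulr_gt0. Qed.
Let p0 : nneg_poly p. Proof. by apply: schroeder_poly_nneg; rewrite ltW. Qed.

Let w0 n : 0 <= w n. Proof. exact: powR_ge0. Qed.

Let w_mul m n : w m.+1 * w n.+1 <= w (m + n).+1.
Proof.
rewrite -powRM ?ler0n// -natrM ge0_ler_powR ?subr_ge0// ?nnegrE ?ler0n//.
by rewrite ler_nat fact_mul_le.
Qed.

Let w_fact n : n`!%:R `^ s = w n * n`!%:R.
Proof. by rewrite mulrC mulr_powRB1// (lt_le_trans _ s1). Qed.

Let Phi0 k : nneg_poly (Phi k).
Proof.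
move=> n; rewrite coef_comp_poly sumr_ge0// => i _; rewrite mulr_ge0//.
  by rewrite coef_derivn mulrn_wge0// coef_poly; case: ifP.
exact: nneg_polyX.
Qed.

Let Phi_coef0 k : (k < L)%N -> (Phi k)`_0 = k`!%:R.
Proof.
move=> kL; rewrite -horner_coef0 horner_comp [p.[0]]horner_coef0.
rewrite schroeder_poly_coef0 horner_coef0 coef_derivn addn0 coef_poly kL.
by rewrite ffactnn.
Qed.

Let Phi_deriv k n : (Phi k.+1 * p^`())`_n = n.+1%:R * (Phi k)`_n.+1.
Proof. by rewrite /Phi derivnS -deriv_comp coef_deriv mulr_natl. Qed.

Lemma gevrey_inner_ge0 n : 0 <= gevrey_inner n.
Proof. by rewrite divr_ge0 ?(ltW dig0)// !mulr_ge0 ?ler0n. Qed.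

Lemma gevrey_inner1 : (0 < N)%N -> gevrey_inner 1 = alpha * vsig * dig.
Proof.
move=> N0; rewrite /gevrey_inner /p -(prednK N0) schroeder_poly_coef1.
by rewrite /w powR1 !mul1r mulfK// gt_eqF.
Qed.

Lemma gevrey_outer0 k : (k < L)%N ->
  gevrey_outer k 0 = k`!%:R `^ s * vsig * dig ^+ k.
Proof.
by move=> kL; rewrite /gevrey_outer Phi_coef0// addn0 w_fact mulr1; ring.
Qed.

Let binconv_outer k n : binconv n (gevrey_outer k) (gevrey_inner \o succn) =
  n`!%:R * vsig * (dig ^+ k / dig) * \sum_(i < n.+1)
    w (k + i) * w (n - i).+1 * ((Phi k)`_i * (p^`())`_(n - i)).
Proof.
have f0 m : m`!%:R != 0 :> K by rewrite pnatr_eq0 -lt0n fact_gt0.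
rewrite binconv_sum -!mulrA; congr (_ * _); rewrite !mulr_sumr.
apply: eq_bigr => i _; rewrite /gevrey_outer /gevrey_inner /=.
rewrite coef_deriv factS natrM -[p`_ _ *+ _]mulr_natl.
by field; rewrite gt_eqF// !f0.
Qed.

(** Coefficient form of the chain rule [(Phi k)' = Phi k.+1 * p']; the inequality comes from the
    weights alone. *)
Lemma gevrey_outer_step k n :
  binconv n (gevrey_outer k.+1) (gevrey_inner \o succn) <= gevrey_outer k n.+1.
Proof.
rewrite binconv_outer exprSr mulfK ?gt_eqF//.
rewrite (_ : gevrey_outer k n.+1 = n`!%:R * vsig * dig ^+ k *
    (w (k + n).+1 * (Phi k.+1 * p^`())`_n)); last first.
  by rewrite Phi_deriv /gevrey_outer factS natrM addnS; ring.
rewrite ler_wpM2l ?mulr_ge0 ?exprn_ge0 ?ler0n ?(ltW vsig0) ?(ltW dig0)//.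
rewrite coefM mulr_sumr; apply: ler_sum => i _.
rewrite ler_wpM2r//; first by rewrite mulr_ge0 ?Phi0// coef_deriv mulrn_wge0 ?p0.
rewrite addSn (le_trans (w_mul _ _))//.
by rewrite -addnA subnKC// -ltnS.
Qed.

(** Apart from the weights, this is the derivative [p' = b + a (Phi 1 - 1) p'] of the fixed-point
    equation, read off at degree [n > 0]. *)
Lemma gevrey_inner_step n : (0 < n < N)%N ->
  alpha * (binconv n (gevrey_outer 1) (gevrey_inner \o succn) -
    gevrey_outer 1 0 * gevrey_inner n.+1) <= gevrey_inner n.+1.
Proof.
move=> /andP[n0 nN].
have Phi1 : (Phi 1)`_0 = 1 by rewrite Phi_coef0.
have -> : gevrey_outer 1 0 * gevrey_inner n.+1 =
    n`!%:R * vsig * (w 1 * w n.+1 * ((Phi 1)`_0 * (p^`())`_n)).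
  rewrite /gevrey_outer /gevrey_inner Phi1 addn0 coef_deriv [n.+1`!]factS natrM.
  by rewrite -[p`_ _ *+ _]mulr_natl fact0 expr1; field; rewrite gt_eqF.
rewrite binconv_outer expr1 divff ?gt_eqF// mulr1 big_ord_recl /= subn0.
rewrite -mulrBr [X in X - _]addrC addn0 addrK.
have sp_rec : a * (\sum_(2 <= j < L) p ^+ j)`_n.+1 = p`_n.+1.
  by apply: schroeder_poly_rec; rewrite ltnS n0.
have -> : gevrey_inner n.+1 = alpha * (n`!%:R * vsig * (w n.+1 *
    (n.+1%:R * (\sum_(2 <= j < L) p ^+ j)`_n.+1))).
  rewrite /gevrey_inner -sp_rec factS natrM /a; field.
  by rewrite gt_eqF.
rewrite ler_wpM2l ?(ltW alpha0)// ler_wpM2l ?mulr_ge0 ?ler0n ?(ltW vsig0)//.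
(* Differentiating [Phi 0], the sum of all [p^j] with [j < L], gives [Phi 1 * p']. Dropping [j = 0]
   and [j = 1] removes [p'], which is the term [i = 0] of the product. *)
have -> : n.+1%:R * (\sum_(2 <= j < L) p ^+ j)`_n.+1 =
    \sum_(i < n) (Phi 1)`_(lift ord0 i) * (p^`())`_(n - lift ord0 i).
  have := Phi_deriv 0 n; rewrite coefM big_ord_recl /= subn0 Phi1 mul1r => E.
  apply: (addrI (p^`())`_n); rewrite E coef_deriv -[p`_n.+1 *+ _]mulr_natl -mulrDr.
  congr (_ * _); transitivity (\sum_(0 <= j < L) (p ^+ j)`_n.+1).
    by rewrite [RHS]big_ltn// [X in _ = _ + X]big_ltn// expr0 coef1 expr1 add0r coef_sum.
  rewrite big_mkord /Phi derivn0 coef_comp_poly size_poly_eq ?oner_eq0//.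
  by apply: eq_bigr => j _; rewrite coef_poly ltn_ord mul1r.
rewrite mulr_sumr; apply: ler_sum => i _; rewrite ler_wpM2r//.
  by rewrite mulr_ge0 ?Phi0// coef_deriv mulrn_wge0 ?p0.
rewrite /bump add1n (le_trans (w_mul _ _))//.
by rewrite subnKC.
Qed.

(* [theta / a] with [theta = 1 - sqrt 2 / 2] is a supersolution of
   [y = b r + a y^2 / (1 - y)] at [r = 1 / (c a b)], and [theta] is the double
   root of this equation for [a = 1]. *)
Lemma gevrey_inner_le n : (0 < n <= N)%N ->
  let c := 3 + Num.sqrt 8 in
  gevrey_inner n <= n`!%:R `^ s * (1 / (c * alpha * vsig * dig ^+ 2)) *
    (c * alpha ^+ 2 * vsig ^+ 2 * dig ^+ 3) ^+ n.
Proof.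
move=> nN; set t := Num.sqrt 8; rewrite /=.
have t0 : 0 <= t := sqrtr_ge0 _.
have t2 : t * t = 8 by rewrite -expr2 sqr_sqrtr// ler0n.
have t_lb : 14 / 5 <= t.
  by rewrite leNgt; apply/negP => tlt; have := ltr_pM t0 t0 tlt tlt; lra.
(* For [theta = 1 - t / 4] this says [theta <= 2 * (3 - t)], which gives [y <= 2 * (b * r)]
   below. *)
have t_ub : t <= 20 / 7 by rewrite leNgt; apply/negP => tgt; nra.
set c := 3 + t; have c0 : 0 < c by rewrite /c; lra.
have cV : c^-1 = 3 - t.
  have cn0 : c != 0 by rewrite gt_eqF.
  by apply: (mulfI cn0); rewrite mulfV// /c mulrDl !mulrBr t2; lra.
pose theta := 1 - t / 4.
have a1 : 1 <= a by rewrite /a !mulr_ege1.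
pose r := (c * a * b)^-1; pose y := theta / a.
have r0 : 0 < r by rewrite invr_gt0 !mulr_gt0.
have br : b * r = (3 - t) / a by rewrite /r -cV; field; rewrite !gt_eqF.
have th0 : 0 <= theta by rewrite /theta; lra.
have th1 : theta < 1 by rewrite /theta; lra.
have yth : y <= theta by rewrite ler_pdivrMr// ler_peMr.
have y01 : 0 <= y < 1.
  by rewrite divr_ge0 ?(ltW a0)//= (le_lt_trans yth).
(* As [y <= theta], the denominator may be replaced by [1 - theta]. Multiplying by [a] then leaves
   [3 - t + theta^2 / (1 - theta) <= theta], which is an equality. *)
have rec : b * r + a * (y ^+ 2 / (1 - y)) <= y.
  have : y ^+ 2 / (1 - y) <= y ^+ 2 / (1 - theta).
    have [y0 y1] := andP y01.
    by rewrite ler_wpM2l ?exprn_ge0// lef_pV2 ?posrE ?subr_gt0// lerD2l lerN2.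
  move=> /(ler_wpM2l (ltW a0)) H; rewrite -lerBrDl (le_trans H)//.
  rewrite br /y -mulrBl expr_div_n expr2 -[a ^+ 2]/(a * a).
  have -> : a * (theta * theta / (a * a) / (1 - theta)) = theta * theta / (1 - theta) / a.
    by field; rewrite !gt_eqF ?subr_gt0.
  rewrite ler_pM2r ?invr_gt0// ler_pdivrMr ?subr_gt0// /theta; nra.
have y2 : y <= 2 * (b * r).
  by rewrite br mulrA ler_pM2r ?invr_gt0// /theta; lra.
have := schroeder_poly_coef_le L (ltW a0) (ltW b0) r0 y01 rec y2 nN.
rewrite -/p -ler_pdivlMr ?exprn_gt0// => pn.
(* The constants of the theorem are read off from the radius [r] and from the coefficient bound
   [b * r], divided by [dig]. *)
have -> : c * alpha ^+ 2 * vsig ^+ 2 * dig ^+ 3 = r^-1.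
  by rewrite /r invrK /b /a; ring.
have -> : 1 / (c * alpha * vsig * dig ^+ 2) = b * r / dig.
  by rewrite br -cV /a; field; rewrite !gt_eqF.
rewrite /gevrey_inner w_fact mulrAC -[leRHS]mulrA -[leLHS]mulrA.
rewrite ler_wpM2l ?mulr_ge0 ?ler0n// [leRHS]mulrAC [leLHS]mulrC.
by rewrite ler_wpM2r ?invr_ge0 ?(ltW dig0)// exprVn.
Qed.

End GevreyMajorant.

(** * From directional to Frechet derivatives *)

Section SmoothFromDirectional.
Context {K : realType} {X Y : normedModType K} (O : set X) (oO : open O).
Context (f : X -> Y) (B : nat -> K).
Hypothesis B0 : forall n, 0 <= B n.
Hypothesis df : forall n, differentiable_upto O n f.
Hypothesis fB : forall vs x, (0 < size vs)%N -> unit_seq vs -> O x ->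
  `|dd vs f x| <= B (size vs).

(** Homogeneity in each direction reduces arbitrary directions to normalized ones. *)
Let dd_scale vs : exists us, [/\ size us = size vs, unit_seq us &
  forall x, O x -> is_diff x (dd vs f)
    ((\prod_(v <- vs) `|v|) \*: ('d (dd us f) x : X -> Y)) /\
    dd vs f x = (\prod_(v <- vs) `|v|) *: dd us f x].
Proof.
have dZ k us ws x : unit_seq us -> O x ->
    {in O, k \*: dd us f =1 dd ws f} ->
    is_diff x (dd ws f) (k \*: ('d (dd us f) x : X -> Y)).
  move=> us1 Ox E; apply: (open_eq_is_diff oO Ox E); apply: is_diffZ.
  exact/differentiableP/(df (ltnSn (size us))).
elim: vs => [|v ws [us [sus us1 E]]].
  exists [::]; split=> // x Ox; rewrite big_nil scale1r; split=> //.
  by apply: dZ => // y _; rewrite /= scale1r.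
(* Also true for [v = 0], where the inverse takes the default value 0 and both sides vanish. *)
have vE : v = `|v| *: (`|v|^-1 *: v).
  have [->|v0] := eqVneq v 0; first by rewrite !scaler0.
  by rewrite scalerA divff ?normr_eq0// scale1r.
have u1 : `|(`|v|^-1 *: v)| <= 1.
  rewrite normrZ normfV normr_id.
  have [->|v0] := eqVneq v 0; first by rewrite normr0 mulr0.
  by rewrite mulVf// normr_eq0.
have E' x : O x -> dd (v :: ws) f x =
    (\prod_(w <- v :: ws) `|w|) *: dd (`|v|^-1 *: v :: us) f x.
  move=> Ox; have [[_ /= ->] _] := E x Ox.
  by rewrite big_cons [in LHS]vE linearZ /= scalerA.
exists (`|v|^-1 *: v :: us); split=> [|/=|x Ox]; first by rewrite /= sus.
  by rewrite u1.
split; last exact: E'.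
by apply: dZ => // [|y]; [rewrite /= u1|rewrite inE => /E' ->].
Qed.

Lemma dd_differentiable vs x : O x -> differentiable (dd vs f) x.
Proof. by move=> Ox; have [us [_ _ /(_ x Ox)[[]]]] := dd_scale vs. Qed.

Lemma norm_dd_le vs x : (0 < size vs)%N -> O x ->
  `|dd vs f x| <= B (size vs) * \prod_(v <- vs) `|v|.
Proof.
move=> s0 Ox; have [us [sus us1 /(_ x Ox)[_ ->]]] := dd_scale vs.
have P0 : 0 <= \prod_(v <- vs) `|v| by rewrite prodr_ge0.
by rewrite normrZ ger0_norm// mulrC ler_wpM2r// -sus fB// sus.
Qed.

Let prod_codom n (h : 'I_n -> X) : \prod_(v <- codom h) `|v| = \prod_i `|h i|.
Proof. by rewrite big_map big_enum. Qed.

Let dd_taylor vs x w d : (forall z, `|z| < d -> O (x + z)) -> `|w| < d ->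
  `|dd vs f (w + x) - dd vs f x - dd (w :: vs) f x| <=
  B (size vs).+2 * (`|w| * (`|w| * \prod_(v <- vs) `|v|)).
Proof.
move=> Od wd; rewrite [w + x]addrC.
have Ot t : 0 <= t <= 1 -> O (x + t *: w).
  move=> /andP[t0 t1]; apply: Od; rewrite normrZ ger0_norm// (le_lt_trans _ wd)//.
  by rewrite ler_piMl.
apply: taylor1_inequality => t t01.
- exact/dd_differentiable/Ot.
- by apply: (@dd_differentiable (w :: vs)); exact: Ot.
- have := @norm_dd_le [:: w, w & vs] (x + t *: w) isT (Ot t t01).
  by rewrite !big_cons.
Qed.

(** The candidate differential sends [w] to [h |-> dd (w :: codom h) f x]. By [dd_taylor] the
    remainder is at most [B n.+2] |w|^2 uniformly over unit [h], hence small in operator norm. *)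
Lemma Dn_differentiable_dd n :
  (forall x h, O x -> Dn n f x h = dd (codom h) f x) ->
  forall x, O x -> differentiable (Dn n f) x.
Proof.
move=> Dnf x Ox.
have LP w : (fun h : 'I_n -> X => dd (w :: codom h) f x) \in @bmlin_pred K n X Y.
  apply/asboolP; split=> [i v a u z|]; last first.
    exists (B n.+1 * `|w|) => v.
    have := @norm_dd_le (w :: codom v) x isT Ox.
    by rewrite /= size_codom card_ord big_cons prod_codom mulrA.
  (* Multilinearity of the candidate is obtained by differentiating in the direction [w] the
     multilinearity of [Dn n f y], valid for all [y] in [O]. *)
  have E : {in O, a \*: dd (codom [eta v with i |-> u]) f +
      dd (codom [eta v with i |-> z]) f =1
      dd (codom [eta v with i |-> a *: u + z]) f}.
    move=> y; rewrite inE => Oy.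
    rewrite -[LHS]/(a *: dd (codom [eta v with i |-> u]) f y +
      dd (codom [eta v with i |-> z]) f y).
    by rewrite -!Dnf// bmlin_multilinear.
  have dE : is_diff x (a \*: dd (codom [eta v with i |-> u]) f +
      dd (codom [eta v with i |-> z]) f)
    (a \*: ('d (dd (codom [eta v with i |-> u]) f) x : X -> Y) +
     ('d (dd (codom [eta v with i |-> z]) f) x : X -> Y)).
    by apply: is_diffD; [apply: is_diffZ|]; exact/differentiableP/dd_differentiable.
  by have [_ /= ->] := open_eq_is_diff oO Ox E dE.
pose L w : bmlin n X Y := Bmlin (LP w).
suff [] : is_diff x (Dn n f) L by [].
have prod1 (v : 'I_n -> X) : (forall i, `|v i| <= 1) -> \prod_i `|v i| <= 1.
  by move=> v1; apply: prodr_ile1 => i _; rewrite normr_ge0 v1.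
apply: is_diff_eps => [a u z||e e0].
- by apply/val_inj/funext => h; rewrite /= linearP.
- exists (B n.+1) => w; apply: bmlin_norm_ub => v v1.
  rewrite (le_trans (@norm_dd_le (w :: codom v) x isT Ox))//=.
  rewrite size_codom card_ord big_cons prod_codom ler_wpM2l//.
  by rewrite ler_piMr// prod1.
have /nbhs_normP[d d0 dO] := open_nbhs_nbhs (conj oO Ox).
have Od z : `|z| < d -> O (x + z).
  by move=> zd; apply: dO; rewrite /ball_ /= opprD addrA subrr add0r normrN.
have B1 : 0 < B n.+2 + 1 by rewrite ltr_wpDl.
exists (Num.min d (e / (B n.+2 + 1))); first by rewrite lt_min d0 divr_gt0.
move=> w; rewrite lt_min => /andP[wd we].
apply: bmlin_norm_ub => v v1.
rewrite -[X in `|X| <= _]/(Dn n f (w + x) v - Dn n f x v - dd (w :: codom v) f x).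
have Owx : O (w + x) by rewrite addrC; exact: Od.
rewrite !Dnf// (le_trans (dd_taylor _ Od wd))//.
rewrite size_codom card_ord prod_codom.
apply: (@le_trans _ _ ((B n.+2 + 1) * (`|w| * `|w|))).
  rewrite ler_pM ?mulr_ge0 ?prodr_ge0//; first by rewrite lerDl.
  by rewrite ler_wpM2l// ler_piMr// prod1.
rewrite mulrA ler_wpM2r// mulrC -ler_pdivlMr//; exact: ltW.
Qed.

(** The first argument of [Dn] is the direction differentiated last, like the head of the list in
    [dd]. At each order the identity yields differentiability of [Dn n f], which in turn yields the
    identity at the next order. *)
Lemma Dn_dd n x (h : 'I_n -> X) : O x -> Dn n f x h = dd (codom h) f x.
Proof.
elim: n x h => [|n IH] x h Ox.
  by rewrite Dn0E (_ : codom h = [::])//; apply: size0nil; rewrite size_codom card_ord.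
have dDn := Dn_differentiable_dd IH.
rewrite (DnSE _ (dDn x Ox)); have ev := is_diff_bmlin_eval (h \o lift ord0)
  (differentiableP (dDn x Ox)).
have -> : codom h = h ord0 :: codom (h \o lift ord0).
  by rewrite /codom /image_mem !enum_ordSl /= -map_comp.
have E : {in O, (fun y => Dn n f y (h \o lift ord0)) =1 dd (codom (h \o lift ord0)) f}.
  by move=> y; rewrite inE => Oy; rewrite IH.
by have [_ /= ->] := open_eq_is_diff oO Ox E ev.
Qed.

Lemma smooth_on_dd : smooth_on O f.
Proof. by move=> n x Ox; apply: (Dn_differentiable_dd _ Ox) => y h; exact: Dn_dd. Qed.

Lemma norm_Dn_le n x : (0 < n)%N -> O x -> `|Dn n f x| <= B n.
Proof.
move=> n0 Ox; apply: bmlin_norm_ub => v v1; rewrite Dn_dd//.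
have sv : size (codom v) = n by rewrite size_codom card_ord.
rewrite -{2}sv; apply: fB => //; first by rewrite sv.
by apply/allP => _ /codomP[i ->].
Qed.

End SmoothFromDirectional.

(** * Application to the data-to-solution map *)

Section PartialDerivative.
Context {K : realType}.

(** Continuity bounds the set whose supremum is [opnorm M], so that this supremum is a genuine
    one. *)
Lemma norm_le_opnorm (X Y : normedModType K) (M : {linear X -> Y}) x :
  continuous M -> `|M x| <= opnorm M * `|x|.
Proof.
move=> /linear_lipschitz[k k0 Mk].
have [->|x0] := eqVneq x 0; first by rewrite linear0 !normr0 mulr0.
have nx : 0 < `|x| by rewrite normr_gt0.
rewrite -ler_pdivrMr// mulrC.
have -> : `|x|^-1 * `|M x| = `|M (`|x|^-1 *: x)|.
  by rewrite linearZ normrZ normfV normr_id.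
apply: ub_le_sup; last first.
  by exists (`|x|^-1 *: x) => //=; rewrite normrZ normfV normr_id mulVf ?gt_eqF.
exists k => _ [z z1 <-]; rewrite (le_trans (Mk z))// ler_piMr// ltW//.
Qed.

Lemma D2E (E F G : normedModType K) (f : E * F -> G) d u v :
  differentiable f (d, u) -> D2 f d u v = 'd f (d, u) (0, v).
Proof.
move=> df; rewrite /D2.
have dp : is_diff u (fun v => (d, v)) (fun h => (0, h)) by apply: is_diff_pair.
have [dp' dpE] := dp.
by rewrite -[fun v => f (d, v)]/(f \o (fun v => (d, v))) diff_comp//= dpE.
Qed.

End PartialDerivative.

Section GevreySolution.
Context {K : realType} {X V Y : normedModType K} (O : set X) (oO : open O).
Context (R : X * V -> Y) (S : X -> V) (s alpha vsig dig : K).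
Hypotheses (s1 : 1 <= s) (alpha1 : 1 <= alpha) (vsig1 : 1 <= vsig) (dig1 : 1 <= dig).
Hypothesis dR : forall n x, O x -> differentiable (Dn n R) (x, S x).
Hypothesis RS0 : forall x, O x -> R (x, S x) = 0.
Hypothesis cS : forall x, O x -> {for x, continuous S}.
Hypothesis invR : forall x, O x -> exists M : Y -> V,
  [/\ linear M, forall w, `|M w| <= alpha * `|w|
    & forall v, M ('d R (x, S x) (0, v)) = v].
Hypothesis Rle : forall n x, O x ->
  `|Dn n R (x, S x)| <= n`!%:R `^ s * vsig * dig ^+ n.

Let alpha0 : 0 < alpha. Proof. exact: lt_le_trans alpha1. Qed.

(** Induction on [n] for a fixed truncation order [N]: the bounds on [S] obtained so far control
    [D R] along the graph, and the recursion of the majorant then gives the next derivative of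
    [S]. *)
Lemma derivatives_le_solution N n v : (n < N)%N -> `|v| <= 1 ->
  derivatives_le O n (gevrey_inner s alpha vsig dig N \o succn)
    (fun x => 'd S x v).
Proof.
set tau := gevrey_inner s alpha vsig dig N.
pose c := gevrey_outer s alpha vsig dig N.
move=> + v1; elim: n v v1 => [|n IH] v v1 nN.
  apply/derivatives_le0 => x Ox; rewrite /tau /= gevrey_inner1//.
  rewrite (le_trans (norm_diff_solution oO alpha0 dR RS0 cS invR v Ox))//.
  rewrite -mulrA -[leRHS]mulrA ler_wpM2l ?(ltW alpha0)//.
  rewrite -[leRHS]mulr1 ler_pM// (le_trans (Rle 1 Ox))//.
  by rewrite powR1 mul1r.
have tau1 : 1 <= tau 1 by rewrite /tau gevrey_inner1 ?mulr_ege1//; exact: leq_trans nN.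
have tau0 i : 0 <= tau i by apply: gevrey_inner_ge0.
have IH' u : `|u| <= 1 -> derivatives_le O n (tau \o succn) (fun x => 'd S x u).
  by move=> u1; apply: IH => //; exact: ltnW.
have PS := derivatives_le_diff_graph oO alpha0 dR RS0 cS invR tau1 tau0 IH'.
apply: (@derivatives_le_solution_step _ _ _ _ O oO R S alpha alpha0 dR RS0 cS invR
  tau (c 1%N) n tau1 tau0 _ IH' _ v v1); last exact: gevrey_inner_step.
apply: (derivatives_le_Dn_comp oO (L := N.+3) (N := n) _ _ _ PS) => //; last by lia.
- move=> x Ox; apply: differentiable_pair => //.
  exact: (solution_differentiable oO alpha0 dR RS0 cS invR).
- by move=> x n' Ox; exact: dR.
- by move=> x n' Ox n'N; rewrite /c gevrey_outer0// Rle.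
- by move=> i n' _; exact: gevrey_outer_step.
Qed.

Let c : K := 3 + Num.sqrt 8.

(** The majorant depends on [N], its closed bound [B] does not; [N] is therefore chosen anew for
    each order of differentiation. *)
Lemma gevrey_solution : smooth_on O S /\ forall n x, (0 < n)%N -> O x ->
  `|Dn n S x| <= n`!%:R `^ s * (1 / (c * alpha * vsig * dig ^+ 2)) *
    (c * alpha ^+ 2 * vsig ^+ 2 * dig ^+ 3) ^+ n.
Proof.
pose B n := n`!%:R `^ s * (1 / (c * alpha * vsig * dig ^+ 2)) *
    (c * alpha ^+ 2 * vsig ^+ 2 * dig ^+ 3) ^+ n.
have ge0 (z : K) : 1 <= z -> 0 <= z by exact: le_trans.
have c0 : 0 <= c by rewrite addr_ge0 ?sqrtr_ge0.
have B0 n : 0 <= B n.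
  have [a0 v0 d0] := And3 (ge0 _ alpha1) (ge0 _ vsig1) (ge0 _ dig1).
  by rewrite /B !(mulr_ge0, powR_ge0, exprn_ge0, invr_ge0, ler01).
have dS n : differentiable_upto O n S.
  move=> vs x _; case/lastP: vs => [_ Ox|vs v].
    exact: (solution_differentiable oO alpha0 dR RS0 cS invR).
  rewrite /unit_seq all_rcons dd_rcons => /andP[v1 vs1] Ox.
  (* Differentiability is guaranteed only strictly below the order of the bounds, hence the order
     [(size vs).+1]. *)
  have [+ _] := derivatives_le_solution (ltnSn (size vs).+1) v1.
  by apply.
have SB vs x : (0 < size vs)%N -> unit_seq vs -> O x -> `|dd vs S x| <= B (size vs).
  case/lastP: vs => [//|vs v] _.
  rewrite /unit_seq all_rcons dd_rcons size_rcons => /andP[v1 vs1] Ox.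
  have [_ /(_ vs x (leqnn _) vs1 Ox)] := derivatives_le_solution (ltnSn (size vs)) v1.
  by move=> /le_trans; apply; apply: gevrey_inner_le => //=.
split; first exact: (smooth_on_dd oO B0 dS SB).
move=> n x n0 Ox; exact: (norm_Dn_le oO B0 dS SB).
Qed.

End GevreySolution.
Unset Implicit Arguments.

Theorem theorem6 (K : realType) (XD XU XR : completeNormedModType K)
    (D : set XD) (U : set XU) (R : XD * XU -> XR) (d0 : XD) (u0 : XU)
    (D' : set XD) (S : XD -> XU) (Dt : set XD) (Ut : set XU)
    (s alpha vsig dig : K) :
  open D -> open U -> smooth_on (D `*` U) R ->
  D d0 -> U u0 -> R (d0, u0) = 0 ->
  banach_isomorphism (D2 R d0 u0) ->
  open D' -> D' d0 -> D' `<=` D ->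
  data_to_solution_map R U d0 u0 D' S ->
  1 <= s -> 1 <= alpha -> 1 <= vsig -> 1 <= dig ->
  open Dt -> Dt d0 -> Dt `<=` D ->
  open Ut -> Ut u0 -> Ut `<=` U ->
  D' `<=` Dt -> S @` D' `<=` Ut ->
  (forall d u n, Dt d -> Ut u ->
     `|Dn n R (d, u)| <= n`!%:R `^ s * vsig * dig ^+ n) ->
  (forall d, D' d ->
     exists2 M : {linear XR -> XU},
       bounded_inverse (D2 R d (S d)) M & opnorm M <= alpha) ->
  let c := 3 + Num.sqrt 8 in
  let vsigt := 1 / (c * alpha * vsig * dig ^+ 2) in
  let digt := c * alpha ^+ 2 * vsig ^+ 2 * dig ^+ 3 in
  smooth_on D' S /\
  forall n, (0 < n)%N ->
    (ereal_sup [set `|Dn n S d|%:E | d in D'] <=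
       (n`!%:R `^ s * vsigt * digt ^+ n)%:E)%E.
Proof.
move=> oD oU smR Dd0 Uu0 R0 isoR oD' D'd0 D'D [[cS SU Sd0 RS0] _].
move=> s1 alpha1 vsig1 dig1 oDt Dtd0 DtD oUt Utu0 UtU D'Dt SUt Rle invR c vsigt digt.
have dR n x : D' x -> differentiable (Dn n R) (x, S x).
  by move=> D'x; apply: smR; split; [exact: D'D|exact: SU].
(* On an open set, continuity of the restriction is continuity at each point in the whole space. *)
have cS' x : D' x -> {for x, continuous S}.
  move=> D'x; move: cS; rewrite continuous_open_subspace// => /(_ x); apply.
  by rewrite inE.
have Rle' n x : D' x -> `|Dn n R (x, S x)| <= n`!%:R `^ s * vsig * dig ^+ n.
  by move=> D'x; apply: Rle; [exact: D'Dt|apply: SUt; exists x].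
have invR' x : D' x -> exists M : XR -> XU,
    [/\ linear M, forall w, `|M w| <= alpha * `|w|
      & forall v, M ('d R (x, S x) (0, v)) = v].
  move=> D'x; have [M [_ cM AM _] Ma] := invR x D'x; exists M; split.
  - exact: linearP.
  - by move=> w; rewrite (le_trans (norm_le_opnorm _ cM))// ler_wpM2r.
  - have [dRx _] := is_diff_Dn1 (dR 0%N x D'x).
    by move=> v; rewrite -D2E// AM.
have [smS SB] := gevrey_solution oD' s1 alpha1 vsig1 dig1 dR RS0 cS' invR' Rle'.
split=> // n n0; apply: ge_ereal_sup => _ [x D'x <-].
by rewrite lee_fin; exact: SB.
Qed.
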